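(* Let $k$ be a field and let $P$ be a set with a symmetric and reflexive relation $\mathcal{C}$. (i) Let $D$ be an arbitrary heap of $H(P,\mathcal{C})$. Then there exists a unique heap $G\in H(P,\mathcal{C})$ with property P2 such that $D=\delta^m G$ in the algebra $TL(P,\mathcal{C})$ (for some integer $m\geq 0$). We have $$\dim\ker\partial_D=m+\dim\ker\partial_G .$$ In particular, if $H(P,\mathcal{C})$ is a regular class of heaps then $m=\dim\ker\partial_D$. (ii) Suppose $H(P,\mathcal{C})$ is a regular class of heaps and let $E$ and $F$ be heaps of $H(P,\mathcal{C})$ with property P2, regarded as basis elements of $TL(P,\mathcal{C})$. Then there is a basis element $G$ of $TL(P,\mathcal{C})$ (i.e. the image of a heap with property P2) for which $E\circ F=\delta^{\dim\ker\partial_{E\circ F}}\,G$ in $TL(P,\mathcal{C})$.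
   Context: Let $P$ be a set with a symmetric and reflexive relation $\mathcal{C}$ (the concurrency relation). A labelled heap with pieces in $P$ is a triple $(E,\leq,\varepsilon)$, where $(E,\leq)$ is a finite (possibly empty) poset and $\varepsilon:E\to P$ is a map such that: (1) if $a,b\in E$ and $\varepsilon(a)\,\mathcal{C}\,\varepsilon(b)$, then $a$ and $b$ are comparable in $\leq$; (2) $\leq$ is the transitive closure of the relation $\leq_{\mathcal{C}}$ defined by $a\leq_{\mathcal{C}}b$ iff $a\leq b$ and $\varepsilon(a)\,\mathcal{C}\,\varepsilon(b)$. A heap $[E,\leq,\varepsilon]$ is an isomorphism class of labelled heaps (isomorphisms being poset isomorphisms compatible with the labellings); $H(P,\mathcal{C})$ is the set (class) of such heaps. One works with representatives. Minimal and maximal vertices are with respect to $\leq$. Subheap: for $F\subseteq E$, the subheap on $F$ is $[F,\leq',\varepsilon|_F]$, where $\leq'$ is the transitive closure of the relation ''$a\leq b$ and $\varepsilon(a)\,\mathcal{C}\,\varepsilon(b)$'' on $F$. For $v\in E$, $E(v)$ is the subheap on $E\setminus\{v\}$. A trivial heap is one whose order relation is trivial (no two distinct elements comparable). Superposition: for heaps $E,F$ in $H(P,\mathcal{C})$, $E\circ F$ has underlying set the disjoint union of $E$ and $F$, labelling restricting to those of $E$ and $F$, and order the transitive closure of the relation $\mathcal{R}$ with $a\,\mathcal{R}\,b$ iff ($a,b\in E$ and $a\leq_E b$) or ($a,b\in F$ and $a\leq_F b$) or ($a\in E$, $b\in F$ and $\varepsilon(a)\,\mathcal{C}\,\varepsilon(b)$).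 This makes $H(P,\mathcal{C})$ a monoid. The map $\partial$: fix a field $k$. $C_0$ is the $k$-vector space with basis the vertices of $E$. $C_1$ is the $k$-vector space with basis the edges of $E$, an edge being a pair $(x,y)\in E\times E$ with $x<y$, $\varepsilon(x)=\varepsilon(y)$, and no $z$ with $x<z<y$ and $\varepsilon(z)=\varepsilon(x)$. The linear map $\partial_E:C_1\to C_0$ is given by $\partial_E((x,y))=\sum w$, the sum over all $w\in E$ with $x<w<y$ and $\varepsilon(w)\,\mathcal{C}\,\varepsilon(x)$. Property P1: write $E(a)\prec^+E$ (respectively $E(a)\prec^-E$) if $a$ is a maximal (respectively minimal) vertex of $E$ and there is a maximal (respectively minimal) vertex $b$ of $E(a)$ with $\varepsilon(b)\neq\varepsilon(a)$ such that $b$ is not maximal (respectively minimal) in $E$. Write $E(a)\prec E$ if $E(a)\prec^+E$ or $E(a)\prec^-E$. $E$ has property P1 if there is a (possibly trivial) sequence $E_1\prec E_2\prec\cdots\prec E$ of heaps in $H(P,\mathcal{C})$ with $E_1$ a trivial heap. Property P2: a chain $x_1<\cdots<x_t$ in $E$ is convex if whenever $x_i<y<x_j$ for some $y\in E$, then $y$ is in the chain. $E$ has property P2 if it contains no convex chain of the form $x<y<z$ or $x<z$ with $\varepsilon(x)=\varepsilon(z)$ in either case. $H(P,\mathcal{C})$ is regular if every heap of $H(P,\mathcal{C})$ with property P2 also has property P1. The algebra: let $\mathcal{A}=\mathbb{Z}[v,v^{-1}]$ and $\delta=v+v^{-1}$. Let $\mathrm{Co}(P,C)$ be the quotient of the free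 monoid $P^*$ by the congruence generated by $st\equiv ts$ for all $s,t\in P$ that are not related by $\mathcal{C}$. $TL(P,\mathcal{C})$ is the quotient of the monoid algebra $\mathcal{A}\,\mathrm{Co}(P,C)$ by the relations $ss=\delta s$ for $s\in P$ and $sts=s$ for $s,t\in P$ with $s\neq t$ and $s\,\mathcal{C}\,t$. A heap $E$ with $n$ elements is regarded as the element of $\mathrm{Co}(P,C)$ represented by the word $p_1p_2\cdots p_n$, $p_i=\varepsilon(\pi^{-1}(i))$, where $\pi:E\to\{1,\dots,n\}$ is any bijection with $a<b\Rightarrow\pi(a)<\pi(b)$; this is independent of $\pi$ and gives a monoid isomorphism $H(P,\mathcal{C})\cong\mathrm{Co}(P,C)$. In this way every heap is regarded as an element of $TL(P,\mathcal{C})$. The images of the heaps with property P2 form a free $\mathcal{A}$-basis of $TL(P,\mathcal{C})$; these are the ''basis elements''. *)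

(* Defs.v *)
From HB Require Import structures.
From mathcomp Require Import all_boot all_order all_algebra.
From mathcomp Require Import boolp.
From mathcomp Require Import monalg.

Set Implicit Arguments.
Unset Strict Implicit.
Unset Printing Implicit Defensive.

Import GRing.Theory.
Local Open Scope ring_scope.
Local Open Scope quotient_scope.

(* A = Z[v, v^-1], as the subring of Z(v) of the fractions p / v^n. *)
Notation fracZ := {fraction {poly int}}.

Definition laurent_pred : {pred fracZ} := fun x =>
  `[< exists (p : {poly int}) (n : nat), x = tofrac p / tofrac 'X ^+ n >].

Fact tofracX_neq0 : tofrac ('X : {poly int}) != 0.
Proof. by rewrite tofrac_eq0 polyX_eq0. Qed.

Fact laurent_closed : subring_closed laurent_pred.
Proof.
have X0 n : tofrac ('X : {poly int}) ^+ n != 0.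
  by rewrite expf_neq0 // tofracX_neq0.
split.
- by apply/asboolP; exists 1, 0; rewrite tofrac1 expr0 divr1.
- move=> x y /asboolP[p [n ->]] /asboolP[q [m ->]]; apply/asboolP.
  exists (p * 'X^m - q * 'X^n), (n + m)%N.
  by rewrite exprD tofracB !tofracM !tofracXn -mulNr addf_div // mulNr.
- move=> x y /asboolP[p [n ->]] /asboolP[q [m ->]]; apply/asboolP.
  by exists (p * q), (n + m)%N; rewrite exprD tofracM mulf_div.
Qed.

HB.instance Definition _ :=
  GRing.isSubringClosed.Build fracZ laurent_pred laurent_closed.

Record laurent := Laurent { laurent_val :> fracZ; _ : laurent_val \in laurent_pred }.
HB.instance Definition _ := [isSub for laurent_val].
HB.instance Definition _ := [Choice of laurent by <:].
HB.instance Definition _ := [SubChoice_isSubComNzRing of laurent by <:].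

Fact laurent_v_subproof : tofrac ('X : {poly int}) \in laurent_pred.
Proof. by apply/asboolP; exists 'X, 0; rewrite expr0 divr1. Qed.

Fact laurent_vV_subproof : (tofrac ('X : {poly int}))^-1 \in laurent_pred.
Proof. by apply/asboolP; exists 1, 1; rewrite tofrac1 expr1 div1r. Qed.

Definition lv : laurent := Laurent laurent_v_subproof.
Definition lvV : laurent := Laurent laurent_vV_subproof.

Lemma lv_lvV : lv * lvV = 1.
Proof. by apply/val_inj; rewrite /= divff ?tofracX_neq0. Qed.

Definition delta : laurent := lv + lvV.

Record concurrency (P : Type) := Concurrency {
  conc :> rel P;
  conc_refl : reflexive conc;
  conc_sym : symmetric conc }.

Section Heaps.
Variables (P : choiceType) (C : concurrency P).

(* A labelled heap.  The transitive closure in condition (2) is rendered by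
   [connect], the reflexive-transitive closure: the closed relation is already
   reflexive because [C] and the order are. *)
Record heap := Heap {
  hcar :> finType;
  hle : rel hcar;
  hlab : hcar -> P;
  hle_refl : reflexive hle;
  hle_anti : antisymmetric hle;
  hle_trans : transitive hle;
  hle_conc : forall a b, C (hlab a) (hlab b) -> hle a b || hle b a;
  hle_gen : hle =2 connect (fun a b => hle a b && C (hlab a) (hlab b)) }.

Arguments hle {h}.
Arguments hlab {h}.

Definition hlt (E : heap) (a b : E) : bool := (a != b) && hle a b.

(* Heaps are isomorphism classes; we work with representatives up to [hiso]. *)
Definition hiso (E F : heap) : Prop :=
  exists f : E -> F, [/\ bijective f,
    forall a b, hle (f a) (f b) = hle a b & forall a, hlab (f a) = hlab a].

Section Subheap.
Variables (E : heap) (F : {set E}).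

Definition sub_rel (a b : {x : E | x \in F}) : bool :=
  hle (val a) (val b) && C (hlab (val a)) (hlab (val b)).

Definition sub_le : rel {x : E | x \in F} := connect sub_rel.

Lemma sub_le_le a b : sub_le a b -> hle (val a) (val b).
Proof.
case/connectP=> p; elim: p a => [|c p IH] a /=.
  by move=> _ ->; apply: hle_refl.
by case/andP=> /andP[ac _] pP /(IH _ pP); apply: hle_trans.
Qed.

Fact sub_refl : reflexive sub_le.
Proof. by move=> a; apply: connect0. Qed.

Fact sub_anti : antisymmetric sub_le.
Proof.
move=> a b /andP[/sub_le_le ab /sub_le_le ba]; apply/val_inj.
by apply: hle_anti; rewrite ab.
Qed.

Fact sub_trans : transitive sub_le.
Proof. exact: connect_trans. Qed.

Fact sub_conc (a b : {x : E | x \in F}) :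
  C (hlab (val a)) (hlab (val b)) -> sub_le a b || sub_le b a.
Proof.
move=> Cab; case/orP: (hle_conc Cab) => h.
  by rewrite [sub_le a b]connect1 // /sub_rel h.
by rewrite orbC [sub_le b a]connect1 // /sub_rel h conc_sym.
Qed.

Fact sub_gen : sub_le =2 connect (fun a b : {x : E | x \in F} =>
  sub_le a b && C (hlab (val a)) (hlab (val b))).
Proof.
move=> a b; apply/idP/idP.
  apply: connect_sub => x y /[dup] xy /andP[_ Cxy].
  by apply: connect1; rewrite Cxy andbT; apply: connect1.
by apply: connect_sub => x y /andP[].
Qed.

Definition subheap : heap := @Heap {x : E | x \in F} sub_le
  (fun x => hlab (val x)) sub_refl sub_anti sub_trans sub_conc sub_gen.

End Subheap.

Definition del (E : heap) (v : E) : heap := subheap [set~ v].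

Section Superposition.
Variables (E F : heap).

Definition sup_lab (x : E + F) : P :=
  match x with inl a => hlab a | inr b => hlab b end.

Definition sup_rel : rel (E + F) := fun x y =>
  match x, y with
  | inl a, inl b => hle a b
  | inr a, inr b => hle a b
  | inl a, inr b => C (hlab a) (hlab b)
  | inr _, inl _ => false
  end.

Definition sup_le : rel (E + F) := connect sup_rel.

Lemma sup_le_inv x y : sup_le x y ->
  match x, y with
  | inl a, inl b => hle a b : Prop
  | inr a, inr b => hle a b
  | inl _, inr _ => True
  | inr _, inl _ => False
  end.
Proof.
case/connectP=> p; elim: p x => [|z p IH] x /=.
  by move=> _ ->; case: x => a; apply: hle_refl.
case/andP=> xz /IH{}IH /IH {IH}.
case: x xz => a; case: z => b //=; case: y => c // ab;
  exact: hle_trans ab.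
Qed.

Fact sup_refl : reflexive sup_le.
Proof. by move=> a; apply: connect0. Qed.

Fact sup_anti : antisymmetric sup_le.
Proof.
move=> [a|a] [b|b] /andP[/sup_le_inv ab /sup_le_inv ba] //;
  by congr (_ _); apply: hle_anti; rewrite ab.
Qed.

Fact sup_trans : transitive sup_le.
Proof. exact: connect_trans. Qed.

Fact sup_conc x y : C (sup_lab x) (sup_lab y) -> sup_le x y || sup_le y x.
Proof.
have H u v : sup_rel u v || sup_rel v u -> sup_le u v || sup_le v u.
  by case/orP=> h; apply/orP; [left|right]; apply: connect1.
case: x y => a [] b /= Cab; apply: H => //=; rewrite ?orbF //.
- exact: hle_conc.
- by rewrite conc_sym.
- exact: hle_conc.
Qed.

Fact sup_gen : sup_le =2
  connect (fun x y => sup_le x y && C (sup_lab x) (sup_lab y)).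
Proof.
move=> x y; apply/idP/idP; last by apply: connect_sub => u v /andP[].
apply: connect_sub => {x y} x y.
set r := fun x y => _.
have r1 u v : sup_rel u v -> C (sup_lab u) (sup_lab v) -> connect r u v.
  by move=> uv Cuv; apply: connect1; rewrite /r Cuv andbT; apply: connect1.
case: x y => [a|a] [b|b] //= ab.
- move: ab; rewrite hle_gen => /connectP[p].
  elim: p a => [|c p IH] a /=; first by move=> _ ->; apply: connect0.
  case/andP=> /andP[ac Cac] /IH{}IH /IH; apply: connect_trans.
  exact: r1.
- exact: r1.
- move: ab; rewrite hle_gen => /connectP[p].
  elim: p a => [|c p IH] a /=; first by move=> _ ->; apply: connect0.
  case/andP=> /andP[ac Cac] /IH{}IH /IH; apply: connect_trans.
  exact: r1.
Qed.

Definition superposition : heap :=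
  @Heap (E + F)%type sup_le sup_lab
    sup_refl sup_anti sup_trans sup_conc sup_gen.

End Superposition.

Definition trivial_heap (E : heap) : Prop :=
  forall a b : E, hle a b -> a = b.

Definition maximal (E : heap) (a : E) : Prop := forall b : E, ~~ hlt a b.
Definition minimal (E : heap) (a : E) : Prop := forall b : E, ~~ hlt b a.

Definition prec_max (E : heap) (a : E) : Prop :=
  maximal a /\ exists b : del a,
    [/\ maximal b, hlab b != hlab a & ~ maximal (val b)].

Definition prec_min (E : heap) (a : E) : Prop :=
  minimal a /\ exists b : del a,
    [/\ minimal b, hlab b != hlab a & ~ minimal (val b)].

Definition prec (E' E : heap) : Prop :=
  exists a : E, hiso E' (del a) /\ (prec_max a \/ prec_min a).

Inductive P1 : heap -> Prop :=
| P1_trivial E : trivial_heap E -> P1 E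
| P1_prec E' E : P1 E' -> prec E' E -> P1 E.

Definition convex_chain (E : heap) (s : seq E) : Prop :=
  sorted (@hlt E) s /\
  forall y a b, a \in s -> b \in s -> hlt a y -> hlt y b -> y \in s.

Definition P2 (E : heap) : Prop :=
  (forall x y z : E, hlab x = hlab z -> ~ convex_chain [:: x; y; z]) /\
  (forall x z : E, hlab x = hlab z -> ~ convex_chain [:: x; z]).

Definition regular : Prop := forall E : heap, P2 E -> P1 E.

Section Boundary.
Variables (k : fieldType) (E : heap).

Definition is_edge (e : E * E) : bool :=
  [&& hlt e.1 e.2, hlab e.1 == hlab e.2 &
      [forall z, ~~ [&& hlt e.1 z, hlt z e.2 & hlab z == hlab e.1]]].

Definition edge : finType := {e : E * E | is_edge e}.

Definition C0 : vectType k := {ffun E -> k^o}.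
Definition C1 : vectType k := {ffun edge -> k^o}.

Definition vertex_vec (w : E) : C0 := [ffun w' => (w' == w)%:R].

Definition boundary_edge (e : edge) : C0 :=
  \sum_(w : E | [&& hlt (val e).1 w, hlt w (val e).2
                  & C (hlab w) (hlab (val e).1)]) vertex_vec w.

Definition boundary_fun (f : C1) : C0 :=
  \sum_(e : edge) (f : {ffun edge -> k^o}) e *: boundary_edge e.

Fact boundary_linear : linear boundary_fun.
Proof.
move=> a f g; rewrite /boundary_fun scaler_sumr -big_split /=.
by apply: eq_bigr => e _; rewrite !ffunE scalerA -scalerDl.
Qed.

HB.instance Definition _ :=
  GRing.isLinear.Build k C1 C0 _ boundary_fun boundary_linear.

Definition boundary : 'Hom(C1, C0) := linfun boundary_fun.

Definition dim_ker : nat := \dim (lker boundary).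

End Boundary.

(* [s] lists E as pi^-1(1), ..., pi^-1(n) for an order-preserving bijection
   pi, so that [index a s] is pi(a) - 1. *)
Definition linear_extension (E : heap) (s : seq E) : bool :=
  [&& uniq s, [forall a, a \in s]
    & [forall a, forall b, hlt a b ==> (index a s < index b s)%N]].

Lemma linear_extension_exists (E : heap) :
  exists s : seq E, linear_extension s.
Proof.
pose d (x : E) := #|[pred y | hle y x]|.
pose s := sort (fun x y => d x <= d y)%N (enum E).
have memS a : a \in s by rewrite mem_sort mem_enum.
exists s; apply/and3P; split; first by rewrite sort_uniq enum_uniq.
  by apply/forallP.
apply/forallP=> a; apply/forallP=> b; apply/implyP=> /andP[neq ab].
rewrite ltnNge; apply/negP=> le_ba.
have: (d b <= d a)%N.
  have srt : sorted (fun x y => d x <= d y)%N s.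
    by apply: sort_sorted => x y; apply: leq_total.
  have tr : transitive (fun x y => d x <= d y)%N.
    by move=> x y z; apply: leq_trans.
  by apply: (sorted_leq_index tr _ srt).
rewrite leqNgt => /negP[]; apply: proper_card; apply/properP; split.
  by apply/subsetP=> x; rewrite !inE => xa; apply: hle_trans ab.
exists b; rewrite !inE ?hle_refl //; apply: contra neq => ba.
by apply/eqP; apply: hle_anti; rewrite ab.
Qed.

(* The choice of linear extension does not matter for the class in [Co]:
   see [heap_co_linear_extension]. *)
Definition heap_word (E : heap) : seq P :=
  map hlab (xchoose (linear_extension_exists E)).

Inductive co_cong : seq P -> seq P -> Prop :=
| co_swap s t : ~~ C s t -> co_cong [:: s; t] [:: t; s]
| co_refl u : co_cong u u
| co_sym u v : co_cong u v -> co_cong v u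
| co_trans u v w : co_cong u v -> co_cong v w -> co_cong u w
| co_cat u v u' v' : co_cong u u' -> co_cong v v' -> co_cong (u ++ v) (u' ++ v').

Definition co_rel (u v : seq P) : bool := `[< co_cong u v >].

Fact co_rel_equiv : equiv_class_of co_rel.
Proof.
split=> [u|u v|v u w].
- by apply/asboolP/co_refl.
- by apply/asboolP/asboolP; apply: co_sym.
- by move=> /asboolP uv /asboolP vw; apply/asboolP/(co_trans uv).
Qed.

Canonical co_equiv := EquivRelPack co_rel_equiv.

Definition Co : Type := {eq_quot co_rel}.
HB.instance Definition _ := Choice.on Co.
HB.instance Definition _ := EqQuotient.on Co.

Definition co_word (u : seq P) : Co := \pi_Co u.

Lemma co_wordP u v : co_word u = co_word v <-> co_cong u v.
Proof.
by split=> [/eqmodP/asboolP//|uv]; apply/eqmodP/asboolP.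
Qed.

Definition co_one : Co := co_word [::].
Definition co_mul (x y : Co) : Co := co_word (repr x ++ repr y).

Lemma co_wordK x : co_word (repr x) = x.
Proof. exact: reprK. Qed.

Lemma co_word_cat u v : co_word (u ++ v) = co_mul (co_word u) (co_word v).
Proof.
apply/co_wordP/co_cat; apply/co_wordP; by rewrite co_wordK.
Qed.

Fact co_mulA : associative co_mul.
Proof.
move=> x y z; rewrite -[x]co_wordK -[y]co_wordK -[z]co_wordK.
by rewrite -!co_word_cat catA.
Qed.

Fact co_mul1l : left_id co_one co_mul.
Proof. by move=> x; rewrite -[x]co_wordK -co_word_cat. Qed.

Fact co_mul1r : right_id co_one co_mul.
Proof. by move=> x; rewrite -[x]co_wordK -co_word_cat cats0. Qed.

Lemma co_cong_size u v : co_cong u v -> size u = size v.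
Proof.
elim=> {u v} //; first by move=> u v w _ -> _ ->.
by move=> u v u' v' _ + _; rewrite !size_cat => -> ->.
Qed.

(* The monomial structure of [monalg] asks for the absence of nontrivial units. *)
Fact co_unit (x y : Co) : co_mul x y = co_one -> x = co_one /\ y = co_one.
Proof.
rewrite -[x]co_wordK -[y]co_wordK -co_word_cat.
move/co_wordP/co_cong_size/size0nil.
by case: (repr x) => [|? ?] //=; case: (repr y).
Qed.

HB.instance Definition _ :=
  Choice_isMonomialDef.Build Co co_mulA co_mul1l co_mul1r co_unit.

Definition heap_co (E : heap) : Co := co_word (heap_word E).

Lemma linear_extension_pairwise (E : heap) (s : seq E) :
  linear_extension s -> pairwise (fun a b => ~~ hlt b a) s.
Proof.
case/and3P=> us /forallP sE /forallP h; case: s us sE h => // x0 s us sE h.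
apply/(pairwiseP x0) => i j si sj ij; apply/negP=> ji.
have /forallP/(_ (nth x0 (x0 :: s) i))/implyP/(_ ji) := h (nth x0 (x0 :: s) j).
by rewrite !index_uniq // ltnNge ltnW.
Qed.

Lemma co_cong_pairwise (E : heap) (s t : seq E) : uniq s -> perm_eq s t ->
  pairwise (fun a b => ~~ hlt b a) s -> pairwise (fun a b => ~~ hlt b a) t ->
  co_cong (map hlab s) (map hlab t).
Proof.
elim: s t => [|x s IH] t /=.
  by move=> _ /perm_size/esym/size0nil-> _ _; apply: co_refl.
case/andP=> xs us st /andP[/allP xs_lt ps] pt.
have /splitPr tE : x \in t by rewrite -(perm_mem st) mem_head.
case: tE st pt => u w st; rewrite pairwise_cat => /and3P[/allrelP uxw pu pxw].
have suw : perm_eq s (u ++ w).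
  by move: st; rewrite -(cat1s x w) perm_sym perm_catCA /= perm_cons perm_sym.
have uw : pairwise (fun a b => ~~ hlt b a) (u ++ w).
  move: pxw => /= /andP[_ pw]; rewrite pairwise_cat pu pw !andbT.
  by apply/allrelP=> a b au bw; apply: uxw => //; rewrite inE bw orbT.
apply: (@co_trans _ (map hlab (x :: u ++ w))).
  exact: (co_cat (co_refl [:: hlab x]) (IH _ us suw ps uw)).
have {uxw} xu y : y \in u -> ~~ C (hlab x) (hlab y).
  move=> yu; have ys : y \in s by rewrite (perm_mem suw) mem_cat yu.
  have nxy : x != y by apply: contraNneq xs => ->.
  apply/negP=> /hle_conc/orP[] le.
    by have := uxw y x yu (mem_head _ _); rewrite /hlt nxy le.
  by have := xs_lt y ys; rewrite /hlt eq_sym nxy le.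
rewrite /= !map_cat /= -cat_rcons -cat_cons; apply: co_cat; last exact: co_refl.
elim: u xu {st suw uw pu} => [|y u IHu] xu /=; first exact: co_refl.
apply: (@co_trans _ ([:: hlab y; hlab x] ++ map hlab u)).
  exact: (co_cat (co_swap (xu y (mem_head _ _))) (co_refl _)).
apply: (co_cat (co_refl [:: hlab y]) (IHu _)) => z zu.
by apply: xu; rewrite inE zu orbT.
Qed.

Lemma heap_co_linear_extension (E : heap) (s : seq E) :
  linear_extension s -> heap_co E = co_word (map hlab s).
Proof.
move=> hs; apply/co_wordP.
have ht := xchooseP (linear_extension_exists E).
have [/and3P[us /forallP sE _] /and3P[ut /forallP tE _]] := (hs, ht).
apply: co_cong_pairwise => //; try exact: linear_extension_pairwise.
by apply: uniq_perm => // a; rewrite sE tE.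
Qed.

Lemma heap_co_hiso (E F : heap) : hiso E F -> heap_co E = heap_co F.
Proof.
case=> f [[g fK gK] f_le f_lab].
have [s hs] := linear_extension_exists E; have /and3P[us /forallP sE _] := hs.
rewrite (heap_co_linear_extension hs).
have -> : map hlab s = map hlab (map f s).
  by rewrite -map_comp; apply: eq_map => a /=; rewrite f_lab.
symmetry; apply: heap_co_linear_extension; apply/and3P; split.
- by rewrite map_inj_uniq //; apply: can_inj fK.
- by apply/forallP=> b; rewrite -[b]gK map_f.
- apply/forallP=> a; apply/forallP=> b; rewrite -[a]gK -[b]gK.
  case/and3P: hs => _ _ /forallP/(_ (g a))/forallP/(_ (g b)).
  by rewrite !(index_map (can_inj fK)) /hlt f_le (can_eq fK).
Qed.

Lemma heap_co_superposition (E F : heap) :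
  heap_co (superposition E F) = co_mul (heap_co E) (heap_co F).
Proof.
have [s hs] := linear_extension_exists E.
have [t ht] := linear_extension_exists F.
rewrite (heap_co_linear_extension hs) (heap_co_linear_extension ht).
rewrite -co_word_cat.
have [r hr] := linear_extension_exists (superposition E F).
rewrite (heap_co_linear_extension hr); apply/co_wordP.
have [/and3P[us /forallP sE _] /and3P[ut /forallP tE _]] := (hs, ht).
have /and3P[ur /forallP rE _] := hr.
pose st : seq (superposition E F) := map inl s ++ map inr t.
have -> : map hlab s ++ map hlab t = map hlab st.
  by rewrite map_cat -!map_comp.
have inlI : injective (@inl E F) by move=> a b [].
have inrI : injective (@inr E F) by move=> a b [].
apply: co_cong_pairwise => //; last first.
- rewrite pairwise_cat; apply/and3P; split.
  + apply/allrelP=> _ _ /mapP[a _ ->] /mapP[b _ ->].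
    by apply/negP=> /andP[_ /sup_le_inv].
  + rewrite pairwise_map; apply: sub_pairwise (linear_extension_pairwise hs).
    move=> a b; apply: contraNN => /andP[ba /sup_le_inv le].
    by rewrite /hlt le andbT; apply: contraNneq ba => ->.
  + rewrite pairwise_map; apply: sub_pairwise (linear_extension_pairwise ht).
    move=> a b; apply: contraNN => /andP[ba /sup_le_inv le].
    by rewrite /hlt le andbT; apply: contraNneq ba => ->.
- exact: linear_extension_pairwise.
apply: uniq_perm => //.
  rewrite cat_uniq !map_inj_uniq // us ut andbT /=.
  by apply/hasPn=> _ /mapP[b _ ->]; apply/mapP=> -[].
move=> x; rewrite rE mem_cat; symmetry; apply/orP.
by case: x => a; [left | right]; apply: map_f.
Qed.

End Heaps.

Arguments hle {P C h}.
Arguments hlab {P C h}.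

Section TemperleyLieb.
Variables (P : choiceType) (C : concurrency P).

Local Notation coAlg := {malg laurent[Co C]}.

Definition co_gen (s : P) : coAlg := << co_word C [:: s] >>.

(* The two-sided ideal of [coAlg] generated by the defining relations. *)
Inductive tl_ideal : coAlg -> Prop :=
| tl_sq s : tl_ideal (co_gen s * co_gen s - delta *: co_gen s)
| tl_braid s t : s != t -> C s t ->
    tl_ideal (co_gen s * co_gen t * co_gen s - co_gen s)
| tl_zero : tl_ideal 0
| tl_sub x y : tl_ideal x -> tl_ideal y -> tl_ideal (x - y)
| tl_mull a x : tl_ideal x -> tl_ideal (a * x)
| tl_mulr a x : tl_ideal x -> tl_ideal (x * a).

Definition tl_pred : {pred coAlg} := fun x => `[< tl_ideal x >].

Fact tl_closed : zmod_closed tl_pred.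
Proof.
split; first exact/asboolP/tl_zero.
by move=> x y /asboolP hx /asboolP hy; apply/asboolP/tl_sub.
Qed.

HB.instance Definition _ := GRing.isZmodClosed.Build coAlg tl_pred tl_closed.

Definition TL : Type := {ideal_quot tl_pred}.
HB.instance Definition _ := GRing.Zmodule.on TL.
HB.instance Definition _ := EqQuotient.on TL.

Definition tl_pi (x : coAlg) : TL := \pi_TL x.

Lemma tl_piP x y : tl_pi x = tl_pi y <-> tl_ideal (x - y).
Proof.
split=> [/eqP|h]; first by rewrite -Quotient.idealrBE => /asboolP.
by apply/eqP; rewrite -Quotient.idealrBE; apply/asboolP.
Qed.

Lemma tl_piK x : tl_pi (repr x) = x.
Proof. exact: reprK. Qed.

Lemma tl_piB : {morph tl_pi : x y / x - y}.
Proof. by move=> x y; apply: raddfB. Qed.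

Lemma tl_piD : {morph tl_pi : x y / x + y}.
Proof. by move=> x y; apply: raddfD. Qed.

Definition tl_one : TL := tl_pi 1.
Definition tl_mul (x y : TL) : TL := tl_pi (repr x * repr y).
Definition tl_scale (c : laurent) (x : TL) : TL := tl_pi (c *: repr x).

Lemma tl_piM x y : tl_pi (x * y) = tl_mul (tl_pi x) (tl_pi y).
Proof.
apply/tl_piP; set x' := repr _; set y' := repr _.
have hx : tl_ideal (x - x') by apply/tl_piP; rewrite tl_piK.
have hy : tl_ideal (y' - y) by apply/tl_piP; rewrite tl_piK.
have -> : x * y - x' * y' = (x - x') * y - x' * (y' - y).
  by rewrite mulrBl mulrBr opprB addrA subrK.
by apply: tl_sub; [apply: tl_mulr | apply: tl_mull].
Qed.

Lemma tl_piZ c x : tl_pi (c *: x) = tl_scale c (tl_pi x).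
Proof.
apply/tl_piP; rewrite -scalerBr -mul_malgC; apply: tl_mull.
by apply/tl_piP; rewrite tl_piK.
Qed.

Fact tl_mulA : associative tl_mul.
Proof.
move=> x y z; rewrite -[x]tl_piK -[y]tl_piK -[z]tl_piK.
by rewrite -!tl_piM mulrA.
Qed.

Fact tl_mul1l : left_id tl_one tl_mul.
Proof. by move=> x; rewrite -[x]tl_piK -tl_piM mul1r. Qed.

Fact tl_mul1r : right_id tl_one tl_mul.
Proof. by move=> x; rewrite -[x]tl_piK -tl_piM mulr1. Qed.

Fact tl_mulDl : left_distributive tl_mul +%R.
Proof.
move=> x y z; rewrite -[x]tl_piK -[y]tl_piK -[z]tl_piK.
by rewrite -tl_piD -!tl_piM -tl_piD mulrDl.
Qed.

Fact tl_mulDr : right_distributive tl_mul +%R.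
Proof.
move=> x y z; rewrite -[x]tl_piK -[y]tl_piK -[z]tl_piK.
by rewrite -tl_piD -!tl_piM -tl_piD mulrDr.
Qed.

(* The generators, hence the ideal, are killed by the augmentation sending
   every [s : P] to 0. *)
Lemma tl_ideal_coeff1 x : tl_ideal x -> x@_mone = 0.
Proof.
have g0 s : (co_gen s)@_mone = 0.
  rewrite mcoeffU1; case: eqP => // /co_wordP/co_cong_size //.
elim=> {x} [s|s t _ _||x y _ hx _ hy|a x _ hx|a x _ hx].
- by rewrite mcoeffB mcoeffZ rmorphM /= g0 !mulr0 subr0.
- by rewrite mcoeffB !rmorphM /= !g0 mulr0 subr0.
- exact: mcoeff0.
- by rewrite mcoeffB hx hy subr0.
- by rewrite rmorphM /= hx mulr0.
- by rewrite rmorphM /= hx mul0r.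
Qed.

Fact tl_one_neq0 : tl_one != 0.
Proof.
apply/eqP; rewrite -(raddf0 (\pi_TL)) => /tl_piP.
rewrite subr0 => /tl_ideal_coeff1 /eqP.
by rewrite mcoeff1 eqxx oner_eq0.
Qed.

HB.instance Definition _ := GRing.Zmodule_isNzRing.Build TL
  tl_mulA tl_mul1l tl_mul1r tl_mulDl tl_mulDr tl_one_neq0.

Fact tl_scaleA a b x : tl_scale a (tl_scale b x) = tl_scale (a * b) x.
Proof. by rewrite -[x]tl_piK -!tl_piZ scalerA. Qed.

Fact tl_scale1 : left_id 1 tl_scale.
Proof. by move=> x; rewrite -[x]tl_piK -tl_piZ scale1r. Qed.

Fact tl_scaleDr : right_distributive tl_scale +%R.
Proof.
move=> a x y; rewrite -[x]tl_piK -[y]tl_piK.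
by rewrite -tl_piD -!tl_piZ -tl_piD scalerDr.
Qed.

Fact tl_scaleDl x : {morph tl_scale^~ x : a b / a + b}.
Proof. by move=> a b; rewrite -[x]tl_piK -!tl_piZ -tl_piD scalerDl. Qed.

HB.instance Definition _ := GRing.Zmodule_isLmodule.Build laurent TL
  tl_scaleA tl_scale1 tl_scaleDr tl_scaleDl.

Fact tl_scaleAl (a : laurent) (x y : TL) : a *: (x * y) = (a *: x) * y.
Proof.
rewrite -[x]tl_piK -[y]tl_piK.
change (tl_scale a (tl_mul (tl_pi (repr x)) (tl_pi (repr y))) =
        tl_mul (tl_scale a (tl_pi (repr x))) (tl_pi (repr y))).
by rewrite -!(tl_piZ, tl_piM) -scalerAl.
Qed.

HB.instance Definition _ := GRing.Lmodule_isLalgebra.Build laurent TL tl_scaleAl.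

Lemma malgC_central (c : laurent) (x : coAlg) : x * c%:MP = c%:MP * x.
Proof.
rewrite !malgM_def fgmulgU fgmulUg; apply: eq_bigr => u _.
by rewrite mulrC mulm1 mul1m.
Qed.

Fact tl_scaleAr (a : laurent) (x y : TL) : a *: (x * y) = x * (a *: y).
Proof.
rewrite -[x]tl_piK -[y]tl_piK.
change (tl_scale a (tl_mul (tl_pi (repr x)) (tl_pi (repr y))) =
        tl_mul (tl_pi (repr x)) (tl_scale a (tl_pi (repr y)))).
rewrite -!(tl_piZ, tl_piM); congr tl_pi.
by rewrite -!mul_malgC !mulrA malgC_central.
Qed.

HB.instance Definition _ := GRing.Lalgebra_isAlgebra.Build laurent TL tl_scaleAr.

Definition heap_tl (E : heap C) : TL := tl_pi << heap_co E >>.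

Lemma heap_tl_hiso (E F : heap C) : hiso E F -> heap_tl E = heap_tl F.
Proof. by move=> EF; rewrite /heap_tl (heap_co_hiso EF). Qed.

Lemma heap_tl_superposition (E F : heap C) :
  heap_tl (superposition E F) = heap_tl E * heap_tl F.
Proof.
rewrite -[RHS]tl_piM /heap_tl heap_co_superposition; congr tl_pi.
by rewrite malgM_def fgmulUU mulr1.
Qed.

End TemperleyLieb.

(* Main.v *)
From HB Require Import structures.
Require Import Defs.
From mathcomp Require Import all_boot all_order all_algebra.
From mathcomp Require Import boolp monalg.

(** Contract a heap D as long as it contains an edge (x, z), that is, two
    consecutive pieces with the same label s, having at most one concurrent
    vertex inside.  An empty edge is a factor ss = delta s up to commutation, and
    an edge around a single vertex of label t is a factor sts = s; in both cases
    the result is the subheap that forgets z and the vertices inside the edge.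
    A heap has property P2 exactly when no contraction applies ([P2_redex]), so
    every D reduces to some G with property P2, with D = delta^m G.

    The pair (m, G) is unique because contraction is confluent: two contractions
    of the same heap give isomorphic heaps or can be joined by one more
    contraction each ([reduct_diamond]).  Hence, for each heap G with property
    P2, the linear functional sending a heap D to delta^m if D reduces to G in
    this way, and to 0 otherwise, is well defined and kills the ideal defining
    the Temperley-Lieb algebra ([normal_coeff_ideal]).  This separates the heaps
    with property P2 and makes m readable from the equation D = delta^m G
    ([normal_form_unique]).

    The kernel of the boundary map follows each contraction
    ([dim_ker_step]).  Contracting an empty edge deletes a zero column of the
    matrix and the row of z, which duplicates that of x.  When the edge contains
    y alone, its column is the unit vector of y; eliminating it removes the row
    of y, and the difference of the rows of x and z forces equal coefficients on
    the edges below and above y, which merge into one edge.  So the dimension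
    drops by m altogether.

    For a heap with property P1 the kernel vanishes ([P1_acyclic]): each step of
    the construction adds an extremal vertex a together with at most one edge,
    and the row of the vertex b provided by P1 forces the coefficient of that
    edge to be 0.  In a regular class this applies to G, so m is the dimension
    of the kernel for D.  The second part is the case of a superposition. *)

Set Implicit Arguments.
Unset Strict Implicit.
Unset Printing Implicit Defensive.
Import GRing.Theory.
Local Open Scope ring_scope.

(** * Heaps through their concurrent pairs *)

Section ConcurrentOrder.
Variables (P : choiceType) (C : concurrency P).
Implicit Types E F : heap C.

(** The concurrent part of the order generates it and is inherited by subheaps
    as it stands, unlike the order itself. *)
Definition clt E : rel E := fun a b => hlt a b && C (hlab a) (hlab b).

Lemma clt_conc E (a b : E) : clt a b -> C (hlab a) (hlab b).
Proof. by case/andP. Qed.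

Lemma clt_concV E (a b : E) : clt a b -> C (hlab b) (hlab a).
Proof. by rewrite conc_sym => /clt_conc. Qed.

Lemma cltW E (a b : E) : clt a b -> hle a b.
Proof. by case/andP=> /andP[]. Qed.

Lemma clt_irr E (a : E) : clt a a = false.
Proof. by rewrite /clt /hlt eqxx. Qed.

Lemma clt_neq E (a b : E) : clt a b -> a != b.
Proof. by case/andP=> /andP[]. Qed.

Lemma hle_hlt_trans E (b a c : E) : hle a b -> hlt b c -> hlt a c.
Proof.
move=> ab /andP[nbc bc]; rewrite /hlt (hle_trans ab bc) andbT.
apply: contraNneq nbc => ac; apply/eqP/(@hle_anti _ _ _ b c).
by rewrite bc -ac.
Qed.

Lemma hlt_hle_trans E (b a c : E) : hlt a b -> hle b c -> hlt a c.
Proof.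
move=> /andP[nab ab] bc; rewrite /hlt (hle_trans ab bc) andbT.
apply: contraNneq nab => ac; apply/eqP/(@hle_anti _ _ _ a b).
by rewrite ab ac.
Qed.

Lemma hlt_trans E (b a c : E) : hlt a b -> hlt b c -> hlt a c.
Proof. by move=> ab /andP[_]; apply: hlt_hle_trans. Qed.

Lemma clt_trans E (b a c : E) :
  C (hlab a) (hlab c) -> clt a b -> clt b c -> clt a c.
Proof. by move=> Cac /andP[ab _] /andP[bc _]; rewrite /clt (hlt_trans ab bc). Qed.

Lemma clt_total E (a b : E) :
  C (hlab a) (hlab b) -> [\/ a = b, clt a b | clt b a].
Proof.
move=> Cab; have [->|nab] := eqVneq a b; first by constructor 1.
have Cba : C (hlab b) (hlab a) by rewrite conc_sym.
case/orP: (hle_conc Cab) => h; [constructor 2|constructor 3].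
  by rewrite /clt /hlt h Cab nab.
by rewrite /clt /hlt h Cba eq_sym nab.
Qed.

Lemma hle_clt E (a b : E) :
  C (hlab a) (hlab b) -> hle a b = (a == b) || clt a b.
Proof.
move=> Cab; rewrite /clt /hlt Cab andbT.
by have [->|] := eqVneq a b; rewrite ?hle_refl.
Qed.

(** The order of a heap is generated by its concurrent pairs, so a map has only
    these to respect. *)
Lemma hle_homo E F (f : E -> F) :
  (forall a b, C (hlab a) (hlab b) -> hle a b -> hle (f a) (f b)) ->
  forall a b, hle a b -> hle (f a) (f b).
Proof.
move=> f_le a b; rewrite hle_gen => /connectP[p].
elim: p a => [|c p IH] a /=; first by move=> _ ->; apply: hle_refl.
case/andP=> /andP[ac Cac] /IH{}IH /IH; apply: hle_trans; exact: f_le.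
Qed.

(** Matching the vertices that go to the same point respects the concurrent pairs,
    since the ambient relation reads them off on both sides. *)
Lemma hiso_embed (T : eqType) (r : rel T) E F (i : E -> T) (j : F -> T) :
    injective i -> injective j ->
    (forall a, exists b, j b = i a) -> (forall b, exists a, i a = j b) ->
    (forall a b, i a = j b -> hlab a = hlab b) ->
    (forall a b, C (hlab a) (hlab b) -> hle a b = r (i a) (i b)) ->
    (forall a b, C (hlab a) (hlab b) -> hle a b = r (j a) (j b)) ->
  hiso E F.
Proof.
move=> i_inj j_inj ij ji lab_ij hi hj.
have ij' a : exists b, j b == i a by have [b <-] := ij a; exists b.
have ji' b : exists a, i a == j b by have [a <-] := ji b; exists a.
pose f a := xchoose (ij' a); pose g b := xchoose (ji' b).
have jf a : j (f a) = i a by apply/eqP/(xchooseP (ij' a)).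
have ig b : i (g b) = j b by apply/eqP/(xchooseP (ji' b)).
have fK : cancel f g by move=> a; apply: i_inj; rewrite ig jf.
have gK : cancel g f by move=> b; apply: j_inj; rewrite jf ig.
have f_lab a : hlab (f a) = hlab a by symmetry; apply: lab_ij; rewrite jf.
have g_lab b : hlab (g b) = hlab b by apply: lab_ij; rewrite ig.
have f_le a b : hle a b -> hle (f a) (f b).
  apply: hle_homo => {}a {}b Cab; rewrite hi // hj ?jf //.
  by rewrite !f_lab.
have g_le a b : hle a b -> hle (g a) (g b).
  apply: hle_homo => {}a {}b Cab; rewrite hj // hi ?ig //.
  by rewrite !g_lab.
exists f; split=> //; first by exists g.
by move=> a b; apply/idP/idP=> [/g_le|/f_le//]; rewrite !fK.
Qed.

Lemma hiso_refl E : hiso E E.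
Proof. by exists id; split=> //; exists id. Qed.

Lemma hiso_sym E F : hiso E F -> hiso F E.
Proof.
case=> f [[g fK gK] f_le f_lab]; exists g; split; first by exists f.
  by move=> a b; rewrite -[a in RHS]gK -[b in RHS]gK f_le.
by move=> a; rewrite -[a in RHS]gK f_lab.
Qed.

Lemma hiso_trans F E G : hiso E F -> hiso F G -> hiso E G.
Proof.
case=> f [f_bij f_le f_lab] [g [g_bij g_le g_lab]].
exists (g \o f); split; first exact: bij_comp.
  by move=> a b /=; rewrite g_le f_le.
by move=> a /=; rewrite g_lab f_lab.
Qed.

Lemma hiso_card E F : hiso E F -> #|E| = #|F|.
Proof. by case=> f [f_bij _ _]; apply: bij_eq_card f_bij. Qed.

Lemma sub_leE E (S : {set E}) (a b : subheap S) :
  C (hlab a) (hlab b) -> hle a b = hle (val a) (val b).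
Proof.
move=> Cab; apply/idP/idP; first exact: sub_le_le.
by move=> ab; apply: connect1; rewrite /sub_rel ab.
Qed.

Lemma sub_clt E (S : {set E}) (a b : subheap S) :
  clt a b = clt (val a) (val b).
Proof.
rewrite /clt /hlt (inj_eq val_inj) -!andbA; congr (_ && _).
by apply/andP/andP=> -[h Cab]; split=> //; move: h; rewrite sub_leE.
Qed.

Lemma sub_hiso E F (S : {set E}) (S' : {set F}) (f : E -> F) :
    {in S &, injective f} -> f @: S = S' ->
    {in S, forall a, hlab (f a) = hlab a} ->
    {in S &, forall a b, clt (f a) (f b) = clt a b} ->
  hiso (subheap S) (subheap S').
Proof.
move=> f_inj fS f_lab f_clt.
apply: (@hiso_embed F (fun a b => (a == b) || clt a b) _ _
  (fun u : subheap S => f (val u)) (fun u : subheap S' => val u)).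
- by move=> a b /f_inj/val_inj; apply; apply: valP.
- exact: val_inj.
- move=> a; have fa : f (val a) \in S' by rewrite -fS imset_f // (valP a).
  by exists (Sub (f (val a)) fa).
- move=> b; have /imsetP[a aS ->] : val b \in f @: S by rewrite fS (valP b).
  by exists (Sub a aS).
- by move=> a b; rewrite /= => <-; rewrite f_lab //; apply: valP.
- move=> a b Cab; rewrite hle_clt // sub_clt f_clt ?(valP a) ?(valP b) //.
  by rewrite (inj_in_eq f_inj) ?(valP a) ?(valP b).
- by move=> a b Cab; rewrite hle_clt // sub_clt.
Qed.

Lemma subsub_hiso E (S : {set E}) (B : {set subheap S}) (S' : {set E}) :
  (forall a : E, (a \in S') = (a \in val @: B)) ->
  hiso (subheap B) (subheap S').
Proof.
move=> S'B.
apply: (@hiso_embed E (fun a b => (a == b) || clt a b) _ _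
  (fun u : subheap B => val (val u)) (fun u : subheap S' => val u)).
- by move=> a b /val_inj/val_inj.
- exact: val_inj.
- move=> a; have aS' : val (val a) \in S' by rewrite S'B imset_f ?(valP a).
  by exists (Sub (val (val a)) aS').
- move=> b; have /imsetP[a aB ->] : val b \in val @: B by rewrite -S'B (valP b).
  by exists (Sub a aB).
- by move=> a b; rewrite /= => <-.
- by move=> a b Cab; rewrite hle_clt // !sub_clt.
- by move=> a b Cab; rewrite hle_clt // sub_clt.
Qed.

End ConcurrentOrder.

(** * Linear extensions and commutation classes *)

Section Words.
Variables (P : choiceType) (C : concurrency P).
Implicit Types E F : heap C.

(** Concurrent pairs suffice to recognize a linear extension, since they generate
    the order. *)
Lemma linear_extensionP E (s : seq E) :
  reflect [/\ uniq s, forall a, a \in s & pairwise (fun a b => ~~ clt b a) s]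
          (linear_extension s).
Proof.
apply: (iffP idP) => [hs|[us sE ps]].
  have /and3P[us /forallP sE _] := hs; split=> //.
  apply: sub_pairwise (linear_extension_pairwise hs) => a b.
  by apply: contraNN => /andP[].
have idx a b : clt a b -> (index a s < index b s)%N.
  move=> ab; have nab := clt_neq ab; rewrite ltnNge; apply/negP=> le_ba.
  have lt_ba : (index b s < index a s)%N.
    rewrite ltn_neqAle le_ba andbT; apply: contraNneq nab => e.
    by rewrite -(nth_index a (sE a)) -e nth_index.
  have /(pairwiseP a) := ps; move/(_ (index b s) (index a s)).
  by rewrite !inE !index_mem !nth_index ?sE // ab => /(_ isT isT lt_ba).
have idxW a b : hle a b -> (index a s <= index b s)%N.
  rewrite hle_gen => /connectP[p].
  elim: p a => [|c p IH] a /=; first by move=> _ ->.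
  case/andP=> /andP[ac Cac] /IH{}IH /IH; apply: leq_trans.
  by move: ac; rewrite hle_clt // => /orP[/eqP->//|/idx/ltnW].
apply/and3P; split=> //; first exact/forallP.
apply/forallP=> a; apply/forallP=> b; apply/implyP=> /andP[nab /idxW le].
rewrite ltn_neqAle le andbT; apply: contraNneq nab => e.
by rewrite -(nth_index a (sE a)) e nth_index.
Qed.

Lemma linear_extension_index E (s : seq E) (a b : E) : linear_extension s ->
  C (hlab a) (hlab b) -> hle a b = (index a s <= index b s)%N.
Proof.
case/and3P=> us /forallP sE /forallP h Cab.
have lt x y : hlt x y -> (index x s < index y s)%N.
  by move=> xy; have /forallP/(_ y)/implyP := h x; apply.
have [->|/andP[ab _]|/andP[ba _]] := clt_total Cab.
- by rewrite hle_refl leqnn.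
- by rewrite (ltnW (lt _ _ ab)); case/andP: ab.
- rewrite leqNgt (lt _ _ ba); apply/negbTE/negP=> ab.
  case/andP: ba => nba le; case/eqP: nba; apply: (@hle_anti _ _ _ b a).
  by rewrite ab le.
Qed.

(** The class of a heap in the commutation monoid determines which words occur
    as its linear extensions: a commutation can be performed on the vertices
    themselves, since it exchanges two incomparable neighbours. *)
Lemma co_cong_linear_extension E (u v : seq P) : co_cong C u v ->
  forall l r : seq E,
  (forall m, map hlab m = u -> linear_extension (l ++ m ++ r) ->
     exists2 m', map hlab m' = v & linear_extension (l ++ m' ++ r)) /\
  (forall m, map hlab m = v -> linear_extension (l ++ m ++ r) ->
     exists2 m', map hlab m' = u & linear_extension (l ++ m' ++ r)).
Proof.
have swap s t l r m : ~~ C s t -> map hlab m = [:: s; t] ->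
    linear_extension (l ++ m ++ r : seq E) ->
  exists2 m', map hlab m' = [:: t; s] & linear_extension (l ++ m' ++ r).
  case: m => [|a [|b []]] // nC [ea eb] /linear_extensionP[us sE ps].
  exists [:: b; a]; first by rewrite /= ea eb.
  have ab : perm_eq (l ++ [:: b; a] ++ r) (l ++ [:: a; b] ++ r).
    by rewrite perm_cat2l perm_cat2r (perm_catC [:: b] [:: a]).
  apply/linear_extensionP; split.
  - by rewrite (perm_uniq ab).
  - by move=> c; rewrite (perm_mem ab).
  have nlt : ~~ clt a b by apply: contraNN nC => /clt_conc; rewrite ea eb.
  move: ps; rewrite !pairwise_cat /= nlt.
  case/and5P=> /allrelP h1 -> /allrelP h2 _ ->; rewrite /= !andbT.
  apply/andP; split; apply/allrelP=> c d hc hd.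
    by apply: h1 => //; move: hd; rewrite !inE orbCA.
  by apply: h2 => //; move: hc; rewrite !inE orbC.
elim=> {u v} [s t nC|u|u v _ IH|u v w _ IH1 _ IH2|u v u' v' _ IH1 _ IH2] l r.
- split=> m; first exact: swap.
  by apply: swap; rewrite conc_sym.
- by split=> m um hm; exists m.
- by have [] := IH l r.
- have [uv vu] := IH1 l r; have [vw wv] := IH2 l r; split=> m em hm.
    by have [m' em' /vw] := uv _ em hm; apply.
  by have [m' em' /vu] := wv _ em hm; apply.
have hcat (a b a' b' : seq P) :
    (forall l r : seq E, forall m, map hlab m = a ->
      linear_extension (l ++ m ++ r) ->
      exists2 m', map hlab m' = a' & linear_extension (l ++ m' ++ r)) ->
    (forall l r : seq E, forall m, map hlab m = b ->
      linear_extension (l ++ m ++ r) ->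
      exists2 m', map hlab m' = b' & linear_extension (l ++ m' ++ r)) ->
    forall m, map hlab m = a ++ b -> linear_extension (l ++ m ++ r) ->
  exists2 m', map hlab m' = a' ++ b' & linear_extension (l ++ m' ++ r).
  move=> ha hb m em; rewrite -(cat_take_drop (size a) m) -catA => hm.
  have [|m1 e1] := ha _ _ _ _ hm; first by rewrite map_take em take_size_cat.
  rewrite catA => /hb[|m2 e2]; first by rewrite map_drop em drop_size_cat.
  by rewrite -catA => hm'; exists (m1 ++ m2); rewrite ?map_cat ?e1 ?e2 // -catA.
by split; apply: hcat => l' r'; have [] := IH1 l' r'; have [] := IH2 l' r'.
Qed.

Lemma heap_co_word E (u : seq P) : heap_co E = co_word C u ->
  exists2 s : seq E, linear_extension s & map hlab s = u.
Proof.
have hs := xchooseP (linear_extension_exists E) => /co_wordP uE.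
have [h _] := @co_cong_linear_extension E _ _ uE [::] [::].
have [|m em hm] := h (xchoose (linear_extension_exists E)) erefl.
  by rewrite /= cats0.
by exists m; rewrite //= -[m]cats0.
Qed.

Lemma linear_extension_hiso E F (s : seq E) (t : seq F) :
  linear_extension s -> linear_extension t -> map hlab s = map hlab t ->
  hiso E F.
Proof.
move=> hs ht st; have st_sz : size s = size t.
  by rewrite -(size_map hlab) st size_map.
have /linear_extensionP[us sE _] := hs; have /linear_extensionP[ut tE _] := ht.
apply: (@hiso_embed _ _ nat leq E F (index^~ s) (index^~ t)).
- by move=> a b e; rewrite -(nth_index a (sE a)) e nth_index.
- by move=> a b e; rewrite -(nth_index a (tE a)) e nth_index.
- move=> a; have := sE a; rewrite -index_mem; case: (t) ut st_sz => [|b t'].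
    by move=> _ ->.
  by move=> ub -> lt; exists (nth b (b :: t') (index a s)); rewrite index_uniq.
- move=> b; have := tE b; rewrite -index_mem; case: (s) us st_sz => [|a s'].
    by move=> _ <-.
  by move=> ua <- lt; exists (nth a (a :: s') (index b t)); rewrite index_uniq.
- move=> a b e; rewrite -(nth_index a (sE a)) -(nth_index b (tE b)).
  rewrite -(nth_map a (hlab a)) ?index_mem // st e.
  by rewrite (nth_map b) ?index_mem.
- by move=> a b; apply: linear_extension_index.
- by move=> a b; apply: linear_extension_index.
Qed.

(** A linear extension of [F] can be copied onto [E], and the positions in these
    two words with the same labels match the vertices. *)
Lemma heap_co_inj E F : heap_co E = heap_co F -> hiso E F.
Proof.
have [t ht] := linear_extension_exists F.
rewrite [RHS](heap_co_linear_extension ht) => /heap_co_word[s hs st].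
exact: linear_extension_hiso hs ht st.
Qed.

(** The restriction of a linear extension is a linear extension of the
    subheap. *)
Lemma heap_co_subheap E (S : {set E}) (s : seq E) : linear_extension s ->
  heap_co (subheap S) = co_word C (map hlab [seq a <- s | a \in S]).
Proof.
move=> hs; have /linear_extensionP[us sE ps] := hs.
pose t : seq (subheap S) := pmap insub s.
have vt : map val t = [seq a <- s | a \in S].
  rewrite /t (pmap_filter (insubK _)); apply: eq_filter => a.
  by rewrite /= isSome_insub.
rewrite -vt -map_comp; apply: heap_co_linear_extension.
apply/linear_extensionP; split.
- by rewrite pmap_sub_uniq.
- by move=> a; rewrite mem_pmap_sub.
have /(pairwise_filter (mem S)) : pairwise (fun a b => ~~ clt b a) s by [].
rewrite /= -vt pairwise_map; apply: sub_pairwise => a b.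
by rewrite /= sub_clt.
Qed.

Definition empty_heap : heap C.
Proof.
by apply: (@Heap P C void (fun _ _ => true) (of_void P)) => [][].
Defined.

Definition piece (s : P) : heap C.
Proof.
apply: (@Heap P C unit (fun _ _ => true) (fun _ => s)) => //.
- by case=> [] [].
- by case=> [] []; rewrite connect0.
Defined.

Fixpoint word_heap (u : seq P) : heap C :=
  if u is s :: u' then superposition (piece s) (word_heap u') else empty_heap.

Lemma heap_co_word_heap u : heap_co (word_heap u) = co_word C u.
Proof.
elim: u => [|s u IH] /=.
  by rewrite (@heap_co_linear_extension _ _ _ [::]) //;
     apply/linear_extensionP; split=> // -[].
rewrite heap_co_superposition IH (@heap_co_linear_extension _ _ (piece s) [:: tt]).
  by rewrite -co_word_cat.
by apply/linear_extensionP; split=> // -[]; rewrite inE.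
Qed.

Definition co_heap (x : Co C) : heap C := word_heap (repr x).

Lemma co_heapK x : heap_co (co_heap x) = x.
Proof. by rewrite heap_co_word_heap co_wordK. Qed.

End Words.

(** * Contractible edges and property P2 *)

Section Reduction.
Variables (P : choiceType) (C : concurrency P).
Implicit Types E F G : heap C.

Definition between E (x z : E) : {set E} := [set w | clt x w && clt w z].

Lemma betweenP E (x z w : E) :
  reflect (clt x w /\ clt w z) (w \in between x z).
Proof. by rewrite inE; apply: andP. Qed.

Lemma edgeP E (x z : E) :
  reflect [/\ clt x z, hlab x = hlab z
            & forall w, w \in between x z -> hlab w <> hlab x]
          (is_edge (x, z)).
Proof.
apply: (iffP and3P) => /= [[xz /eqP lab_xz /forallP no]|[/andP[xz _] lab_xz no]].
  split=> // [|w /betweenP[/andP[xw _] /andP[wz _]] lab_wx].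
    by rewrite /clt xz lab_xz conc_refl.
  by have := no w; rewrite xw wz lab_wx eqxx.
split=> //; first exact/eqP.
apply/forallP=> w; apply/negP=> /and3P[xw wz /eqP lab_wx].
by apply: (no w); rewrite // inE /clt xw wz lab_wx -?lab_xz !conc_refl.
Qed.

(** A convex chain of the kind excluded by property P2 is an edge with at most
    one concurrent vertex inside. *)
Definition redex E (x z : E) : bool :=
  is_edge (x, z) && (#|between x z| <= 1)%N.

(** The reduct keeps the lower end of the edge, as in ss = s and sts = s. *)
Definition reduct E (x z : E) : heap C := subheap (~: (z |: between x z)).

Lemma redexP E (x z : E) :
  reflect [/\ clt x z, hlab x = hlab z,
              forall w, w \in between x z -> hlab w <> hlab x
            & forall w w', w \in between x z -> w' \in between x z -> w = w']
          (redex x z).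
Proof.
apply: (iffP andP) => [[/edgeP[xz lab_xz no] /card_le1_eqP N1]|[xz lab_xz no N1]].
  by split=> // w w' wN w'N; apply: N1.
split; first exact/edgeP.
by apply/card_le1_eqP=> w w' wN w'N; apply: N1.
Qed.

Lemma hlt_clt_first E (a b : E) : hlt a b -> exists2 c, clt a c & hle c b.
Proof.
case/andP=> nab; rewrite hle_gen => /connectP[p].
elim: p a nab => [|c p IH] a /= nab; first by move=> _ e; rewrite e eqxx in nab.
case/andP=> /andP[ac Cac] pP bE; have [ac'|nac] := eqVneq a c.
  by rewrite ac' in nab *; apply: IH.
exists c; first by rewrite /clt /hlt nac ac.
by rewrite hle_gen; apply/connectP; exists p.
Qed.

Lemma hlt_clt_last E (a b : E) : hlt a b -> exists2 c, clt c b & hle a c.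
Proof.
case/andP=> nab; rewrite hle_gen => /connectP[p].
elim: p a nab => [|d p IH] a /= nab; first by move=> _ e; rewrite e eqxx in nab.
case/andP=> /andP[ad Cad] pP bE; have [db|ndb] := eqVneq d b.
  by exists a; rewrite ?hle_refl // /clt /hlt nab -db ad.
have [c cb dc] := IH d ndb pP bE.
by exists c => //; apply: hle_trans dc.
Qed.

(** Any vertex strictly between the ends of an edge is reached from below, and
    left upwards, through vertices concurrent with the ends.  If the edge has at
    most one such vertex inside, the interval is therefore a chain. *)
Lemma P2_redex E : P2 E <-> forall x z : E, ~~ redex x z.
Proof.
split=> [[no3 no2] x z|no].
  apply/negP=> /redexP[xz lab_xz _ N1].
  have bet y : hlt x y -> hlt y z -> y \in between x z.
    move=> xy yz; have [c xc cy] := hlt_clt_first xy.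
    have [d dz yd] := hlt_clt_last yz.
    have Cxz : C (hlab x) (hlab z) by apply: clt_conc.
    have cN : c \in between x z.
      rewrite inE xc /clt (hle_hlt_trans cy yz) -lab_xz.
      by rewrite (clt_concV xc).
    have dN : d \in between x z.
      rewrite inE dz /clt (hlt_hle_trans xy yd) lab_xz.
      by rewrite (clt_concV dz).
    suff -> : y = c by [].
    by apply: (@hle_anti _ _ _ y c); rewrite cy andbT (N1 c d).
  have xz' : hlt x z by case/andP: xz.
  have chain s : sorted (@hlt _ _ E) s ->
      {in s, forall a, hle x a && hle a z} ->
      {subset between x z <= s} -> convex_chain s.
    move=> s_sorted bnd sub; split=> // y a b /bnd/andP[xa _] /bnd/andP[_ bz].
    move=> ay yb; apply: sub; apply: bet; first exact: hle_hlt_trans ay.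
    exact: hlt_hle_trans bz.
  have [N0|[y yN]] := set_0Vmem (between x z).
    apply: (no2 x z lab_xz); apply: chain; rewrite /= ?xz' // => a.
      by rewrite !inE => /orP[]/eqP->; rewrite hle_refl cltW.
    by rewrite N0 inE.
  have /betweenP[xy yz] := yN.
  apply: (no3 x y z lab_xz); apply: chain => [||a aN].
  - by rewrite /= andbT; case/andP: xy => ->; case/andP: yz => ->.
  - by move=> a; rewrite !inE => /or3P[]/eqP->; rewrite ?hle_refl !cltW.
  - by rewrite (N1 a y) // !inE eqxx orbT.
have ends (s : seq E) (x z w : E) : convex_chain s -> x \in s -> z \in s ->
    w \in between x z -> [/\ w \in s, w != x & w != z].
  move=> [_ conv] xs zs /betweenP[xw wz]; split.
  - by case/andP: xw => xw _; case/andP: wz => wz _; apply: conv xw wz.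
  - by rewrite eq_sym clt_neq.
  - by rewrite clt_neq.
have pair (x z : E) : hlab x = hlab z -> ~ convex_chain [:: x; z].
  move=> lab_xz h; have N0 w : w \notin between x z.
    apply/negP=> /(ends _ _ _ _ h); rewrite !inE !eqxx orbT.
    by case=> // /orP[] ->.
  have /negP[] := no x z; apply/redexP; split=> //.
  - by case: h => /andP[xz _] _; rewrite /clt xz lab_xz conc_refl.
  - by move=> w wN; have := N0 w; rewrite wN.
  - by move=> w w' wN; have := N0 w; rewrite wN.
split=> // x y z lab_xz h.
have mem3 (a b c : E) : c \in between a b -> a \in [:: x; y; z] ->
    b \in [:: x; y; z] -> [/\ c \in [:: x; y; z], c != a & c != b].
  by move=> cN ah bh; apply: ends cN.
have [/= /and3P[xy yz _] _] := h.
have [lab_xy|nlab] := eqVneq (hlab x) (hlab y).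
  have /negP[] := no x y; apply/redexP.
  have N0 w : w \notin between x y.
    apply/negP=> wN; have := mem3 _ _ _ wN; rewrite !inE !eqxx orbT.
    case=> // /or3P[/eqP->|/eqP->|/eqP wz]; rewrite ?eqxx // => _ _.
    case/betweenP: wN => _; rewrite wz => /andP[/andP[nzy zy] _].
    case/andP: yz => _ yz; case/eqP: nzy; apply: (@hle_anti _ _ _ z y).
    by rewrite zy.
  split=> //; first by rewrite /clt xy lab_xy conc_refl.
    by move=> w wN; have := N0 w; rewrite wN.
  by move=> w w' wN; have := N0 w; rewrite wN.
have /negP[] := no x z; apply/redexP.
have N1 w : w \in between x z -> w = y.
  move=> wN; have := mem3 _ _ _ wN; rewrite !inE !eqxx !orbT.
  by case=> // /or3P[]/eqP-> //; rewrite eqxx.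
split=> //; first by rewrite /clt (hlt_trans xy yz) lab_xz conc_refl.
  by move=> w /N1-> /esym; apply/eqP.
by move=> w w' /N1-> /N1->.
Qed.
End Reduction.

(** * Confluence of contractions *)

Section Confluence.
Variables (P : choiceType) (C : concurrency P).
Implicit Types E F G : heap C.

(** Either end of the edge can be kept: outside the edge, [x] and [z] are
    comparable with the same concurrent vertices and in the same way. *)
Lemma reduct_sym E (x z : E) : is_edge (x, z) ->
  hiso (reduct x z) (subheap (~: (x |: between x z))).
Proof.
case/edgeP=> xz lab_xz no.
have nxz := clt_neq xz; have Cxz := clt_conc xz.
have zN : z \notin between x z by rewrite inE clt_irr andbF.
have xN : x \notin between x z by rewrite inE clt_irr.
have clt_x w : w != x -> w != z -> w \notin between x z ->
    clt x w = clt z w /\ clt w x = clt w z.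
  move=> wx wz; rewrite inE negb_and => wN; split; apply/idP/idP => h.
  - have Czw : C (hlab z) (hlab w) by rewrite -lab_xz (clt_conc h).
    have [e|//|wz'] := clt_total Czw; first by rewrite e eqxx in wz.
    by rewrite h wz' in wN.
  - by apply: (clt_trans _ xz h); rewrite lab_xz (clt_conc h).
  - by apply: (clt_trans _ h xz); rewrite -lab_xz (clt_conc h).
  - have Cwx : C (hlab w) (hlab x) by rewrite lab_xz (clt_conc h).
    have [e|//|xw] := clt_total Cwx; first by rewrite e eqxx in wx.
    by rewrite h xw in wN.
pose f w := if w == x then z else w.
have fx : f x = z by rewrite /f eqxx.
have fE w : w != x -> f w = w by rewrite /f => /negbTE->.
have inS w : w \in ~: (z |: between x z) -> w != z /\ w \notin between x z.
  by rewrite !inE negb_or => /andP[-> ->].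
apply: (@sub_hiso _ _ _ _ _ _ f).
- move=> a b /inS[az _] /inS[bz _]; rewrite /f.
  case: eqVneq => [->|ax]; case: eqVneq => [->|bx] // e.
    by rewrite -e eqxx in bz.
  by rewrite e eqxx in az.
- apply/setP=> w; apply/imsetP/idP => [[a aS ->]|].
    have [az aN] := inS _ aS; have [->|ax] := eqVneq a x.
      by rewrite fx in_setC in_setU1 negb_or eq_sym nxz.
    by rewrite fE // in_setC in_setU1 negb_or ax.
  rewrite in_setC in_setU1 negb_or => /andP[wx wN].
  have [->|wz] := eqVneq w z.
    by exists x; rewrite ?fx // in_setC in_setU1 negb_or nxz.
  by exists w; rewrite ?fE // in_setC in_setU1 negb_or wz.
- by move=> a _; rewrite /f; case: eqP => // ->.
- move=> a b /inS[az aN] /inS[bz bN].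
  have [->|ax] := eqVneq a x; have [->|bx] := eqVneq b x.
  + by rewrite !clt_irr.
  + by rewrite fx fE //; case: (clt_x b).
  + by rewrite fx fE //; case: (clt_x a).
  + by rewrite !fE.
Qed.

(** The number [m] counts the factor [delta] of the relation ss = delta s; the
    relation sts = s produces none. *)
Definition step (m : nat) E F : Prop := exists x z : E,
  [/\ redex x z, hiso (reduct x z) F & m = (between x z == set0)].

Lemma step_hisol m E E' F : hiso E E' -> step m E F -> step m E' F.
Proof.
case=> f [f_bij f_le f_lab] [x [z [xz_red redF mE]]].
have f_inj := bij_inj f_bij.
have f_clt a b : clt (f a) (f b) = clt a b.
  by rewrite /clt /hlt f_le !f_lab (inj_eq f_inj).
have bet : between (f x) (f z) = f @: between x z.
  have [g fK gK] := f_bij; apply/setP=> w; rewrite -[w]gK (mem_imset _ _ f_inj).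
  by rewrite !inE !f_clt.
exists (f x), (f z); split.
- have [xz lab_xz no N1] := redexP _ _ xz_red; apply/redexP; split.
  + by rewrite f_clt.
  + by rewrite !f_lab.
  + by move=> w; rewrite bet => /imsetP[v vN ->]; rewrite !f_lab; apply: no.
  + move=> w w'; rewrite bet => /imsetP[v vN ->] /imsetP[v' v'N ->].
    by rewrite (N1 v v').
- apply: hiso_trans redF; apply: hiso_sym; apply: (@sub_hiso _ _ _ _ _ _ f).
  + by move=> a b _ _; apply: f_inj.
  + rewrite bet; apply/setP=> w; have [g fK gK] := f_bij; rewrite -[w]gK.
    by rewrite (mem_imset _ _ f_inj) !inE (inj_eq f_inj) (mem_imset _ _ f_inj) inE.
  + by move=> a _; rewrite f_lab.
  + by move=> a b _ _; rewrite f_clt.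
- by rewrite mE bet -!cards_eq0 card_imset.
Qed.

Lemma step_card m E F : step m E F -> (#|F| < #|E|)%N.
Proof.
case=> x [z [_ /hiso_card<- _]]; rewrite card_sig.
apply: proper_card; apply/properP; split; first exact/subsetP.
by exists z; rewrite // !inE eqxx.
Qed.

(** If the upper end of the second edge is the only vertex inside the first one,
    the lower end of the second edge cannot be; so it lies below the lower end of
    the first edge, which is therefore inside the second one. *)
Lemma edge_inside_lower E (x1 z1 x2 z2 : E) : redex x1 z1 -> redex x2 z2 ->
  z2 \in between x1 z1 -> x1 \in between x2 z2.
Proof.
move=> /redexP[xz1 lab1 no1 N1] /redexP[xz2 lab2 no2 N2] z2N.
have /betweenP[x1z2 z2z1] := z2N; rewrite inE x1z2 andbT.
have Cx : C (hlab x1) (hlab x2) by rewrite lab2 (clt_conc x1z2).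
have [x12|x12|//] := clt_total Cx.
  by case: (no1 z2); rewrite // -lab2 x12.
have x2N : x2 \in between x1 z1.
  by rewrite inE x12 (clt_trans _ xz2 z2z1) // lab2 (clt_conc z2z1).
by have := clt_neq xz2; rewrite (N1 x2 z2) ?eqxx.
Qed.

Lemma edge_inside_upper E (x1 z1 x2 z2 : E) : redex x1 z1 -> redex x2 z2 ->
  x2 \in between x1 z1 -> z1 \in between x2 z2.
Proof.
move=> /redexP[xz1 lab1 no1 N1] /redexP[xz2 lab2 no2 N2] x2N.
have /betweenP[x1x2 x2z1] := x2N; rewrite inE x2z1 /=.
have Cz : C (hlab z1) (hlab z2) by rewrite -lab2 (clt_concV x2z1).
have [z12|//|z21] := clt_total Cz.
  by case: (no1 x2); rewrite // lab2 -z12.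
have z2N : z2 \in between x1 z1.
  by rewrite inE z21 (clt_trans _ x1x2 xz2) // -lab2 (clt_conc x1x2).
by have := clt_neq xz2; rewrite (N1 z2 x2) ?eqxx.
Qed.

Lemma redex_between E (x z y : E) : redex x z -> y \in between x z ->
  between x z = [set y].
Proof.
by move=> /redexP[_ _ _ N1] yN; apply/eqP; rewrite eqEsubset sub1set yN andbT;
  apply/subsetP=> w wN; rewrite inE (N1 w y).
Qed.

(** In an overlap stst, each edge has an end of the other one inside: deleting
    [x1] and its interior, or [z2] and its interior, deletes the first or the
    last two of the four vertices. *)
Lemma reduct_overlap E (x1 z1 x2 z2 : E) : redex x1 z1 -> redex x2 z2 ->
  x2 \in between x1 z1 -> hiso (reduct x1 z1) (reduct x2 z2).
Proof.
move=> r1 r2 x2N; have z1N := edge_inside_upper r1 r2 x2N.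
apply: hiso_trans (hiso_sym (reduct_sym _)); last by case/andP: r2.
rewrite /reduct (redex_between r1 x2N) (redex_between r2 z1N).
by rewrite setUC; apply: hiso_refl.
Qed.

(** Apart from overlaps of the form stst, contracting one edge leaves the other
    contractible: its lower end may have moved (when the edges are stacked), and
    it may have become empty (when they surround the same vertex). *)
Lemma redex_residual E (x1 z1 x2 z2 : E) : redex x1 z1 -> redex x2 z2 ->
    z1 != z2 -> x2 \notin between x1 z1 -> x1 \notin between x2 z2 ->
  exists m, step m (reduct x1 z1)
    (subheap (~: ((z1 |: between x1 z1) :|: (z2 |: between x2 z2)))).
Proof.
move=> r1 r2 nz x2N1 x1N2.
have z2N1 : z2 \notin between x1 z1.
  by apply: contra x1N2; apply: edge_inside_lower.
have [xz1 lab1 no1 N1] := redexP _ _ r1; have [xz2 lab2 no2 N2] := redexP _ _ r2.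
set A1 := z1 |: _; set A2 := z2 |: _.
(* The lower end of the second edge, once [z1] has been merged into [x1]. *)
pose x := if x2 == z1 then x1 else x2.
have [[xz2' lab_xz xA] bet] : [/\ clt x z2, hlab x = hlab z2 & x \notin A1] /\
    forall w, w \notin A1 -> (clt x w && clt w z2) = (w \in between x2 z2).
  rewrite /x; case: eqP => [e|/eqP ne]; last first.
    by split; [rewrite in_setU1 negb_or ne | move=> w _; rewrite inE].
  have lab_x1z2 : hlab x1 = hlab z2 by rewrite lab1 -e.
  split; [split=> // | ].
  - by apply: (clt_trans _ xz1); rewrite -?e // lab_x1z2 conc_refl.
  - by rewrite in_setU1 negb_or (clt_neq xz1) inE clt_irr.
  move=> w; rewrite !inE e negb_or negb_and => /andP[wz1 wN1].
  apply/andP/andP=> -[lo up]; split=> //.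
    have Cwz : C (hlab z1) (hlab w) by rewrite -lab1 (clt_conc lo).
    have [e'|//|wz1'] := clt_total Cwz; first by rewrite e' eqxx in wz1.
    by rewrite lo wz1' in wN1.
  by apply: (clt_trans _ xz1 lo); rewrite lab_x1z2 (clt_concV up).
have z2A : z2 \notin A1 by rewrite in_setU1 negb_or eq_sym nz.
have inC (w : E) : w \notin A1 -> w \in ~: A1 by rewrite in_setC.
pose u : reduct x1 z1 := Sub x (inC _ xA); pose v : reduct x1 z1 := Sub z2 (inC _ z2A).
have betS w : (w \in between u v) = (val w \in between x2 z2).
  rewrite inE !sub_clt /= bet //; have := valP w; by rewrite in_setC.
exists (between u v == set0), u, v; split=> //.
  apply/redexP; split.
  - by rewrite sub_clt.
  - by [].
  - move=> w; rewrite betS => /no2 + e; apply; rewrite lab2 -lab_xz; exact: e.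
  - by move=> w w'; rewrite !betS => h h'; apply/val_inj/N2.
apply: subsub_hiso => a; rewrite in_setC in_setU negb_or.
apply/andP/imsetP=> [[aA1 aA2]|[w wB ->]].
  exists (Sub a (inC _ aA1)) => //; rewrite in_setC in_setU1 negb_or betS.
  by move: aA2; rewrite in_setU1 negb_or -(inj_eq val_inj).
have := valP w; rewrite in_setC => wA1; split=> //.
by move: wB; rewrite in_setC !in_setU1 !negb_or betS -(inj_eq val_inj).
Qed.

Lemma reduct_diamond E (x1 z1 x2 z2 : E) : redex x1 z1 -> redex x2 z2 ->
  hiso (reduct x1 z1) (reduct x2 z2) \/
  exists m1 m2 F, step m1 (reduct x1 z1) F /\ step m2 (reduct x2 z2) F.
Proof.
move=> r1 r2; have [ez|nz] := eqVneq z1 z2.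
  left; suff -> : x1 = x2 by rewrite ez; apply: hiso_refl.
  have [xz1 lab1 no1 _] := redexP _ _ r1; have [xz2 lab2 no2 _] := redexP _ _ r2.
  have lab12 : hlab x1 = hlab x2 by rewrite lab1 lab2 ez.
  have Cx : C (hlab x1) (hlab x2) by rewrite lab12 conc_refl.
  have [//|x12|x21] := clt_total Cx.
    by case: (no1 x2); rewrite // inE x12 ez.
  by case: (no2 x1); rewrite // inE x21 -ez.
have [x2N|x2N] := boolP (x2 \in between x1 z1); first by left; apply: reduct_overlap.
have [x1N|x1N] := boolP (x1 \in between x2 z2).
  by left; apply: hiso_sym; apply: reduct_overlap.
right; have [m1 s1] := redex_residual r1 r2 nz x2N x1N.
have [|m2 s2] := redex_residual r2 r1 _ x1N x2N; first by rewrite eq_sym.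
by exists m1, m2; eexists; split; first exact: s1; rewrite setUC.
Qed.

Inductive reduces : nat -> heap C -> heap C -> Prop :=
| reduces_refl E F : hiso E F -> reduces 0 E F
| reduces_step m n E E' F :
    step m E E' -> reduces n E' F -> reduces (m + n) E F.

Lemma reduces_hisol m E E' F : hiso E E' -> reduces m E F -> reduces m E' F.
Proof.
move=> EE' h; case: h EE' => [{}E {}F EF|{}m n {}E E1 {}F s r] EE'.
  by apply: reduces_refl; apply: hiso_trans EF; apply: hiso_sym.
exact: reduces_step (step_hisol EE' s) r.
Qed.

Lemma not_P2_step E : ~ P2 E -> exists m F, step m E F.
Proof.
move=> nP2; suff [x [z xz]] : exists x z : E, redex x z.
  exists (between x z == set0), (reduct x z), x, z; split=> //.
  exact: hiso_refl.
apply: contrapT => no; apply: nP2; apply/P2_redex=> x z.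
by apply/negP=> xz; apply: no; exists x, z.
Qed.

Lemma P2_step m E F : P2 E -> ~ step m E F.
Proof. by move=> /P2_redex no [x [z [xz _ _]]]; have := no x z; rewrite xz. Qed.

Lemma reduces_P2 E : exists m F, reduces m E F /\ P2 F.
Proof.
have [n] := ubnP #|E|; elim: n E => // n IH E En.
have [hE|/not_P2_step[m [E' s]]] := pselect (P2 E).
  by exists 0, E; split=> //; apply: reduces_refl; apply: hiso_refl.
have [|m' [F [r hF]]] := IH E'; first exact: leq_trans (step_card s) En.
by exists (m + m')%N, F; split=> //; apply: reduces_step s r.
Qed.

(** Induction on the number of vertices: two first steps lead to heaps with a
    common reduct, whose normal form both of them must reach. *)
Lemma reduces_unique m1 m2 E F1 F2 : reduces m1 E F1 -> P2 F1 ->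
  reduces m2 E F2 -> P2 F2 -> hiso F1 F2.
Proof.
have [n] := ubnP #|E|; elim: n E m1 m2 F1 F2 => // n IH E m1 m2 F1 F2 En.
have irred m E' F F' : hiso E' F -> P2 F -> reduces m E' F' -> hiso F F'.
  move=> /[swap] hF /[swap]; case=> [{}E' {}F' iso' /hiso_sym iso|].
    exact: hiso_trans iso'.
  by move=> k k' {}E' E'' {}F' s _ iso; case: (P2_step hF (step_hisol iso s)).
move=> r1 h1 r2 h2; case: r1 En r2 h1.
  by move=> {}E {}F1 iso _ r2 h1; apply: irred iso h1 r2.
move=> m n1 {}E E1 {}F1 s1 r1 En r2 h1.
case: r2 En s1 h2 => [{}E {}F2 iso _ s1 h2|m' n2 {}E E2 {}F2 s2 r2 En s1 h2].
  by case: (P2_step h2 (step_hisol iso s1)).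
have lt1 : (#|E1| < n)%N := leq_trans (step_card s1) En.
have lt2 : (#|E2| < n)%N := leq_trans (step_card s2) En.
have [x1 [z1 [red1 iso1 _]]] := s1; have [x2 [z2 [red2 iso2 _]]] := s2.
have [iso|[k1 [k2 [E3 [t1 t2]]]]] := reduct_diamond red1 red2.
  apply: (IH E1 _ _ _ _ lt1 r1 h1 _ h2); apply: reduces_hisol r2.
  apply: hiso_trans iso1; apply: hiso_trans (hiso_sym iso).
  exact: hiso_sym.
have [k [F3 [r3 h3]]] := reduces_P2 E3.
have r13 := reduces_step (step_hisol iso1 t1) r3.
have r23 := reduces_step (step_hisol iso2 t2) r3.
apply: (@hiso_trans _ _ F3); first exact: (IH E1 _ _ _ _ lt1 r1 h1 r13 h3).
exact: (IH E2 _ _ _ _ lt2 r23 h3 r2 h2).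
Qed.

End Confluence.

(** * The kernel of the boundary map on functions of vertices *)

Section KernelOnVertices.
Variables (k : fieldType) (P : choiceType) (C : concurrency P).
Implicit Types E F G : heap C.

Section Cycles.
Variables (E : heap C) (S : {set E}).

(** An edge of the subheap on [S] is determined by its upper end, and the upper
    ends are the vertices satisfying [has_below]. *)
Definition has_below (z : E) : bool :=
  (z \in S) && [exists x in S, clt x z && (hlab x == hlab z)].

(** If [z] also satisfies [has_below], this says that [w] occurs in the boundary
    of the edge ending at [z]: the lower end of that edge is concurrent with [w],
    and cannot lie between [w] and [z]. *)
Definition next_above (w z : E) : bool :=
  [&& z \in S, clt w z, hlab w != hlab z
    & [forall v in S, ~~ [&& clt w v, clt v z & hlab v == hlab z]]].

Lemma has_belowP z :
  reflect (z \in S /\ exists x, [/\ x \in S, clt x z & hlab x = hlab z])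
          (has_below z).
Proof.
apply: (iffP andP) => -[zS].
  by case/exists_inP=> x xS /andP[xz /eqP e]; split=> //; exists x.
case=> x [xS xz e]; split=> //; apply/exists_inP; exists x => //.
by rewrite xz e eqxx.
Qed.

Lemma next_aboveP w z :
  reflect [/\ z \in S, clt w z, hlab w <> hlab z
            & forall v, v \in S -> clt w v -> clt v z -> hlab v <> hlab z]
          (next_above w z).
Proof.
apply: (iffP and4P) => -[zS wz lab_wz no]; split=> //.
- exact/eqP.
- move=> v vS wv vz e; have /forall_inP/(_ v vS) := no.
  by rewrite wv vz e eqxx.
- exact/eqP.
- apply/forall_inP=> v vS; apply/negP=> /and3P[wv vz /eqP].
  exact: no.
Qed.

Definition cycle_constraints (g : {ffun E -> k^o}) : {ffun E + E -> k^o} :=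
  [ffun c => match c with
    | inl z => if has_below z then 0 else g z
    | inr w => if w \in S then \sum_(z | next_above w z) g z else 0
  end].

Fact cycle_constraints_linear : linear cycle_constraints.
Proof.
move=> a f g; apply/ffunP=> -[z|w]; rewrite !ffunE.
  by case: ifP; rewrite ?ffunE // scaler0 addr0.
case: ifP; last by rewrite scaler0 addr0.
rewrite scaler_sumr -big_split /= => _.
by apply: eq_bigr => z _; rewrite !ffunE.
Qed.

HB.instance Definition _ := GRing.isLinear.Build k {ffun E -> k^o}
  {ffun E + E -> k^o} _ cycle_constraints cycle_constraints_linear.

(** The functions extended by 0 from the upper ends of the edges of [S] that lie
    in the kernel of the boundary map.  As they live on the ambient heap, the
    kernels for different [S] can be compared inside the same space. *)
Definition cycles : {vspace {ffun E -> k^o}} := lker (linfun cycle_constraints).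

Lemma cyclesP (g : {ffun E -> k^o}) :
  reflect ((forall z, ~~ has_below z -> g z = 0) /\
           (forall w, w \in S -> \sum_(z | next_above w z) g z = 0))
          (g \in cycles).
Proof.
rewrite memv_ker lfunE /=; apply: (iffP eqP) => [/ffunP h|[h1 h2]].
  split=> [z /negbTE nz|w wS]; first by have := h (inl z); rewrite !ffunE nz.
  by have := h (inr w); rewrite !ffunE wS.
apply/ffunP=> -[z|w]; rewrite !ffunE; case: ifP => //.
  by move/negbT/h1.
by move/h2.
Qed.

End Cycles.

Lemma edge_between E (e : edge E) (w : E) :
  [&& hlt (val e).1 w, hlt w (val e).2 & C (hlab w) (hlab (val e).1)] =
  (w \in between (val e).1 (val e).2).
Proof.
have [_ lab_e _] : [/\ clt (val e).1 (val e).2, hlab (val e).1 = hlab (val e).2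
    & forall w, w \in between (val e).1 (val e).2 -> hlab w <> hlab (val e).1].
  by apply/edgeP; rewrite -surjective_pairing; apply: (valP e).
rewrite inE /clt -lab_e (conc_sym C (hlab (val e).1)).
by case: hlt; case: hlt; rewrite ?andbF //= andbb.
Qed.

Lemma boundaryE E (f : C1 k E) (w : E) :
  (boundary k E f : {ffun E -> k^o}) w =
  \sum_(e : edge E | w \in between (val e).1 (val e).2) (f : {ffun _ -> k^o}) e.
Proof.
rewrite lfunE /= /boundary_fun sum_ffunE [RHS]big_mkcond /=.
apply: eq_bigr => e _; rewrite ffunE /boundary_edge sum_ffunE -edge_between.
rewrite (eq_bigr (fun v => (v == w)%:R)) => [|v _]; last first.
  by rewrite ffunE eq_sym.
set Q := (Q in \sum_(v | Q v) _); rewrite -[X in if X then _ else _]/(Q w).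
have -> : \sum_(v | Q v) (v == w)%:R = (Q w)%:R :> k^o.
  case: (boolP (Q w)) => Qw.
    by rewrite (bigD1 w) //= eqxx big1 ?addr0 // => v /andP[_ /negbTE->].
  by rewrite big1 // => v Qv; case: eqP Qw => // <-; rewrite Qv.
by case: (Q w); rewrite ?scaler0 // [_ *: _]mulr1.
Qed.

Lemma edge_lower_uniq E (x x' z : E) : is_edge (x, z) -> is_edge (x', z) -> x = x'.
Proof.
move=> /edgeP[xz lab1 no1] /edgeP[xz' lab2 no2].
have lab12 : hlab x = hlab x' by rewrite lab1 lab2.
have Cx : C (hlab x) (hlab x') by rewrite lab12 conc_refl.
have [//|h|h] := clt_total Cx.
  by case: (no1 x'); rewrite // inE h.
by case: (no2 x); rewrite // inE h.
Qed.

(** Take the last vertex before [z] with its label. *)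
Lemma edge_exists E (x z : E) : clt x z -> hlab x = hlab z ->
  exists y, is_edge (y, z).
Proof.
have [n] := ubnP #|between x z|; elim: n x => // n IH x xn xz lab_xz.
have [/existsP[y /andP[yN /eqP lab_yx]]|no] :=
    boolP [exists y, (y \in between x z) && (hlab y == hlab x)]; last first.
  exists x; apply/edgeP; split=> // w wN /eqP lab_w.
  by case/negP: no; apply/existsP; exists w; rewrite wN.
have /betweenP[xy yz] := yN.
apply: (IH y) => //; last by rewrite lab_yx.
apply: leq_trans (xn : (#|between x z| <= n)%N); apply: proper_card.
apply/properP; split; last by exists y; rewrite // inE clt_irr.
apply/subsetP=> w /betweenP[yw wz]; rewrite inE wz andbT.
by apply: (clt_trans _ xy yw); rewrite -lab_yx (clt_conc yw).
Qed.

(** The kernel only depends on the concurrent pairs, so it can be computed in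
    any heap containing the given one; an edge is coded by its upper end. *)
Lemma dim_ker_cycles E F (i : F -> E) (S : {set E}) :
    injective i -> i @: [set: F] = S -> (forall a, hlab (i a) = hlab a) ->
    (forall a b, clt (i a) (i b) = clt a b) ->
  dim_ker k F = \dim (cycles S).
Proof.
move=> i_inj iS i_lab i_clt.
have iin a : i a \in S by rewrite -iS imset_f // inE.
have iP z : z \in S -> exists a, z = i a.
  by rewrite -iS => /imsetP[a _ ->]; exists a.
pose T (f : C1 k F) : {ffun E -> k^o} :=
  [ffun z => \sum_(e : edge F | i (val e).2 == z) (f : {ffun _ -> k^o}) e].
have T_lin : linear T.
  move=> a f g; apply/ffunP=> z; rewrite !ffunE scaler_sumr -big_split /=.
  by apply: eq_bigr => e _; rewrite !ffunE.
pose Tl : {linear C1 k F -> {ffun E -> k^o}} :=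
  HB.pack T (GRing.isLinear.Build _ _ _ _ T T_lin).
have edgeE (e : edge F) : [/\ clt (val e).1 (val e).2,
    hlab (val e).1 = hlab (val e).2
    & forall w, w \in between (val e).1 (val e).2 -> hlab w <> hlab (val e).1].
  by apply/edgeP; rewrite -surjective_pairing; apply: (valP e).
have TE f (e : edge F) : T f (i (val e).2) = (f : {ffun _ -> k^o}) e.
  rewrite ffunE (bigD1 e) //= big1 ?addr0 // => e' /andP[/eqP/i_inj e2 ne].
  case/eqP: ne; apply/val_inj; rewrite [LHS]surjective_pairing.
  rewrite [RHS]surjective_pairing e2; congr (_, _).
  apply: (@edge_lower_uniq _ _ _ (val e).2); last first.
    by rewrite -surjective_pairing; apply: (valP e).
  by rewrite -e2 -surjective_pairing; apply: (valP e').
have next_bet a (e : edge F) :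
    next_above S (i a) (i (val e).2) = (a \in between (val e).1 (val e).2).
  have [lt_e lab_e no] := edgeE e; apply/next_aboveP/betweenP.
    case=> _; rewrite i_clt !i_lab => ae lab_a blk; split=> //.
    have Ca : C (hlab (val e).1) (hlab a) by rewrite lab_e (clt_concV ae).
    have [e1|//|ae1] := clt_total Ca; first by case: lab_a; rewrite -e1.
    by case: (blk (i (val e).1)); rewrite ?i_clt ?i_lab.
  case=> e1a ae2; split; rewrite ?i_clt ?i_lab //.
    by move=> e'; apply: (no a); rewrite ?inE ?e1a // lab_e.
  move=> v /iP[b ->]; rewrite !i_clt !i_lab => ab be2 lab_b.
  apply: (no b); rewrite ?lab_e // inE be2 (clt_trans _ e1a ab) //.
  by rewrite lab_b lab_e conc_refl.
have T_row f a : \sum_(z | next_above S (i a) z) T f z =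
    (boundary k F f : {ffun F -> k^o}) a.
  rewrite boundaryE (eq_bigl (fun e : edge F => next_above S (i a) (i (val e).2))).
    rewrite (partition_big (fun e : edge F => i (val e).2) (next_above S (i a))) //=.
    apply: eq_bigr => z az; rewrite ffunE; apply: eq_bigl => e.
    by case: eqP => [->|]; rewrite ?az ?andbF.
  by move=> e; rewrite next_bet.
rewrite /dim_ker -(@limg_dim_eq _ _ _ (linfun Tl)); last first.
  apply/eqP; rewrite -subv0; apply/subvP=> f; rewrite memv_cap => /andP[_].
  rewrite memv_ker lfunE /= => /eqP Tf0; rewrite memv0; apply/eqP/ffunP=> e.
  by rewrite -TE (Tf0 : T f = 0) !ffunE.
congr (\dim _); apply/eqP; rewrite eqEsubv; apply/andP; split; apply/subvP=> g.
  case/memv_imgP=> f; rewrite memv_ker => /eqP f0 ->; rewrite lfunE /=.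
  apply/cyclesP; split=> [z nz|w /iP[a ->]]; last by rewrite T_row f0 ffunE.
  rewrite ffunE big1 // => e /eqP ez; case/negP: nz; rewrite -ez.
  have [lt_e lab_e _] := edgeE e; apply/has_belowP; split=> //.
  by exists (i (val e).1); rewrite i_clt !i_lab.
case/cyclesP=> g_top g_row; pose f : C1 k F := [ffun e => g (i (val e).2)].
have Tf : T f = g.
  apply/ffunP=> z; have [/has_belowP[zS [x [xS xz lab_xz]]]|nz] := boolP (has_below S z).
    have [b zb] := iP _ zS; have [a xa] := iP _ xS; subst z x.
    move: xz lab_xz; rewrite i_clt !i_lab => xz lab_xz.
    have [y yb] := edge_exists xz lab_xz.
    by have := TE f (Sub (y, b) yb); rewrite [in RHS]ffunE.
  rewrite g_top // ffunE big1 // => e /eqP ez; rewrite ffunE ez.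
  exact: g_top.
apply/memv_imgP; exists f; last by rewrite lfunE /= [T f]Tf.
rewrite memv_ker; apply/eqP/ffunP=> a.
by rewrite -T_row Tf g_row // ffunE.
Qed.

(** Both kernels are computed in [F]. *)
Lemma dim_ker_hiso E F : hiso E F -> dim_ker k E = dim_ker k F.
Proof.
case=> f [f_bij f_le f_lab]; have f_inj := bij_inj f_bij.
rewrite (@dim_ker_cycles F E f [set: F]) //.
- by rewrite (@dim_ker_cycles F F id [set: F]) // imset_id.
- have [g fK gK] := f_bij; apply/setP=> b; rewrite !inE -[b]gK.
  by rewrite imset_f // inE.
- by move=> a b; rewrite /clt /hlt f_le !f_lab (inj_eq f_inj).
Qed.

Lemma dim_ker_subheap E (S : {set E}) : dim_ker k (subheap S) = \dim (cycles S).
Proof.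
apply: (@dim_ker_cycles E (subheap S) val) => //; first exact: val_inj.
- apply/setP=> a; apply/imsetP/idP => [[b _ ->]|aS]; first exact: (valP b).
  by exists (Sub a aS).
- by move=> a b; rewrite sub_clt.
Qed.

Lemma dim_ker_setT E : dim_ker k E = \dim (cycles [set: E]).
Proof. by apply: (@dim_ker_cycles E E id) => //; rewrite imset_id. Qed.

End KernelOnVertices.

(** * The kernel of a contracted heap *)

Lemma edge_upper_uniq (P : choiceType) (C : concurrency P) (E : heap C)
  (x z z' : E) : is_edge (x, z) -> is_edge (x, z') -> z = z'.
Proof.
move=> /edgeP[xz lab1 no1] /edgeP[xz' lab2 no2].
have Cz : C (hlab z) (hlab z') by rewrite -lab1 -lab2 conc_refl.
have [//|h|h] := clt_total Cz.
  by case: (no2 z); rewrite // inE xz h.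
by case: (no1 z'); rewrite // inE xz' h.
Qed.

Section KernelOfReduct.
Variables (k : fieldType) (P : choiceType) (C : concurrency P).
Variables (E : heap C) (x z : E).
Hypothesis xz_edge : is_edge (x, z).
Let nextT := next_above [set: E].

Let xz : clt x z. Proof. by have [] := edgeP _ _ xz_edge. Qed.
Let lab_xz : hlab x = hlab z. Proof. by have [] := edgeP _ _ xz_edge. Qed.

Let nextTP w v : reflect
  [/\ clt w v, hlab w <> hlab v & forall u, clt w u -> clt u v -> hlab u <> hlab v]
  (nextT w v).
Proof.
apply: (iffP (next_aboveP _ _ _)) => [[_ wv lab_wv no]|[wv lab_wv no]].
  by split=> // u; apply: no.
by split=> // u _; apply: no.
Qed.

(** A vertex [w] below [x] would have [x] as its next vertex with that label. *)
Lemma next_upper w : nextT w z -> w \in between x z.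
Proof.
case/nextTP=> wz lab_wz no; rewrite inE wz andbT.
have Cxw : C (hlab x) (hlab w) by rewrite lab_xz (clt_concV wz).
have [e|//|wx] := clt_total Cxw; first by case: lab_wz; rewrite -e.
by case: (no x wx xz).
Qed.

Section Empty.
Hypothesis N0 : between x z = set0.
Let S := ~: [set z].

Let outside w : clt x w -> clt w z -> False.
Proof. by move=> xw wz; have := in_set0 w; rewrite -N0 inE xw wz. Qed.

Let inS w : (w \in S) = (w != z). Proof. by rewrite !inE. Qed.

Let below_S w : has_below S w = (w != z) && has_below [set: E] w.
Proof.
apply/has_belowP/andP.
  case=> wS [u [uS uw e]]; rewrite -inS; split=> //.
  by apply/has_belowP; split; rewrite ?inE //; exists u; rewrite inE.
rewrite -inS => -[wS /has_belowP[_ [u [_ uw e]]]]; split=> //.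
have [uz|nuz] := eqVneq u z; last by exists u; rewrite inS.
exists x; rewrite inS (clt_neq xz) lab_xz -uz e; split=> //.
by apply: (clt_trans _ xz); rewrite -?uz // lab_xz -uz (clt_conc uw).
Qed.

Let next_S w v : w != z -> v != z -> next_above S w v = nextT w v.
Proof.
move=> wz vz; apply/next_aboveP/nextTP=> [[vS wv lab_wv no]|[wv lab_wv no]]; last first.
  by rewrite inS; split=> // u _; apply: no.
split=> // u wu uv e; have [uz|nuz] := eqVneq u z; last by apply: (no u); rewrite ?inS.
rewrite uz in wu uv e.
have Cxw : C (hlab x) (hlab w) by rewrite lab_xz (clt_concV wu).
have [xw|xw|wx] := clt_total Cxw; first by case: lab_wv; rewrite -xw lab_xz.
  exact: outside xw wu.
apply: (no x); rewrite ?inS ?(clt_neq xz) ?lab_xz //.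
by apply: (clt_trans _ xz uv); rewrite lab_xz (clt_conc uv).
Qed.

Let next_xz v : nextT x v = nextT z v.
Proof.
apply/nextTP/nextTP=> -[lt lab_v no].
  have Cv : C (hlab v) (hlab z) by rewrite -lab_xz (clt_concV lt).
  split; rewrite -?lab_xz //.
    have [e|vz|//] := clt_total Cv; first by case: lab_v; rewrite lab_xz -e.
    by case: (outside lt vz).
  move=> u zu uv; apply: no => //.
  by apply: (clt_trans _ xz zu); rewrite lab_xz (clt_conc zu).
split; rewrite ?lab_xz //.
  by apply: (clt_trans _ xz lt); rewrite lab_xz (clt_conc lt).
move=> u xu uv e; have Cu : C (hlab u) (hlab z) by rewrite -lab_xz (clt_concV xu).
have [uz|uz|zu] := clt_total Cu; first by case: lab_v; rewrite -uz.
  exact: outside xu uz.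
exact: (no u).
Qed.

(** When the edge is empty, [z] lies inside the same edges as [x], and the edge
    itself is a cycle. *)
Lemma dim_ker_reduct_empty : dim_ker k E = (dim_ker k (subheap S)).+1.
Proof.
rewrite dim_ker_setT dim_ker_subheap.
pose d : {ffun E -> k^o} := [ffun v => (v == z)%:R].
have nz w : nextT w z = false.
  by apply/negbTE/negP=> /next_upper; rewrite N0 inE.
have nextE w : w != z -> next_above S w =1 nextT w.
  move=> wz v; have [->|vz] := eqVneq v z; last exact: next_S.
  by rewrite nz; apply/negbTE/negP=> /next_aboveP[]; rewrite inS eqxx.
have SE (g : {ffun E -> k^o}) : (g \in cycles k S) = (g \in cycles k [set: E]) && (g z == 0).
  apply/cyclesP/andP=> [[g_top g_row]|[/cyclesP[g_top g_row] /eqP gz]].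
    have gz : g z = 0 by apply: g_top; rewrite below_S eqxx.
    rewrite gz eqxx; split=> //; apply/cyclesP.
    split=> [w nw|w _]; first by apply: g_top; rewrite below_S (negbTE nw) andbF.
    have [->|wz] := eqVneq w z; last first.
      by rewrite -[RHS](g_row w) ?inS //; apply: eq_bigl => v; rewrite nextE.
    rewrite -[RHS](g_row x) ?inS ?(clt_neq xz) //; apply: eq_bigl => v.
    by rewrite nextE ?(clt_neq xz) // next_xz.
  split=> [w|w]; last first.
    rewrite inS => wz; rewrite -[RHS](g_row w) ?inE //.
    by apply: eq_bigl => v; rewrite nextE.
  by rewrite below_S negb_and negbK => /orP[/eqP->//|]; apply: g_top.
have dz : d z = 1 by rewrite ffunE eqxx.
have dT : d \in cycles k [set: E].
  apply/cyclesP; split=> [w nw|w _].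
    rewrite ffunE; case: eqP nw => // -> /negP[]; apply/has_belowP.
    by rewrite inE; split=> //; exists x; rewrite inE.
  apply: big1 => v wv; rewrite ffunE; case: eqP wv => // ->.
  by rewrite -/nextT nz.
have -> : cycles k [set: E] = (cycles k S + <[d]>)%VS.
  apply/eqP; rewrite eqEsubv subv_add -memvE dT andbT; apply/andP; split.
    apply/subvP=> g gT; apply/memv_addP; exists (g - g z *: d); last first.
      by exists (g z *: d); rewrite ?memvZ ?memv_line // subrK.
    rewrite SE memvB ?memvZ //= !ffunE eqxx.
    by rewrite [_ *: _]mulr1 subrr.
  by apply/subvP=> g; rewrite SE => /andP[].
rewrite dimv_disjoint_sum ?dim_vline.
  have -> : d != 0 by apply/eqP=> d0; have /eqP := dz; rewrite d0 ffunE eq_sym oner_eq0.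
  by rewrite addn1.
apply/eqP; rewrite -subv0; apply/subvP=> g; rewrite memv_cap SE.
case/andP=> /andP[_ /eqP gz] /vlineP[c gE]; move: gz; rewrite gE ffunE dz.
by rewrite [_ *: _]mulr1 => ->; rewrite scale0r mem0v.
Qed.
End Empty.

Section Single.
Variable y : E.
Hypothesis N1 : between x z = [set y].
Let S := ~: [set z; y].

Let inside w : clt x w -> clt w z -> w = y.
Proof. by move=> xw wz; apply/set1P; rewrite -N1 inE xw. Qed.

Let xy : clt x y. Proof. by have /setP/(_ y) := N1; rewrite !inE eqxx => /andP[]. Qed.
Let yz : clt y z. Proof. by have /setP/(_ y) := N1; rewrite !inE eqxx => /andP[]. Qed.
Let lab_yx : hlab y <> hlab x.
Proof. by have [_ _ no] := edgeP _ _ xz_edge; apply: no; rewrite N1 inE. Qed.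

Let inS w : (w \in S) = (w != z) && (w != y).
Proof. by rewrite !inE negb_or. Qed.

Let xS : x \in S. Proof. by rewrite inS !clt_neq. Qed.

Let lower_x w : C (hlab z) (hlab w) -> clt w z -> w <> x -> w <> y -> clt w x.
Proof.
move=> Czw wz nwx nwy; have Cxw : C (hlab x) (hlab w) by rewrite lab_xz.
have [e|xw|//] := clt_total Cxw; first by case: nwx.
by case: nwy; apply: inside.
Qed.

Let upper_z w : clt x w -> w <> z -> w <> y -> clt z w.
Proof.
move=> xw nwz nwy; have Cwz : C (hlab w) (hlab z) by rewrite -lab_xz (clt_concV xw).
have [e|wz|//] := clt_total Cwz; first by case: nwz.
by case: nwy; apply: inside.
Qed.

Let edge_y v : is_edge (y, v) -> v \in S.
Proof.
case/edgeP=> yv lab_yv _; rewrite inS [v == y]eq_sym (clt_neq yv) andbT.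
by apply: contra_not_neq lab_yx => vz; rewrite lab_yv vz lab_xz.
Qed.

Let below_S w : has_below S w -> has_below [set: E] w.
Proof.
case/has_belowP=> _ [u [_ uw e]]; apply/has_belowP; rewrite inE; split=> //.
by exists u; rewrite inE.
Qed.

Let not_below_S w : w \in S -> has_below [set: E] w -> ~~ has_below S w ->
  is_edge (y, w) /\ ~~ has_below [set: E] y.
Proof.
move=> wS /has_belowP[_ [u [_ uw lab_uw]]] nb.
have only v : clt v w -> hlab v = hlab w -> v = y.
  move=> vw e; have [//|nvy] := eqVneq v y; case/negP: nb; apply/has_belowP.
  split=> //; have [vz|nvz] := eqVneq v z; last by exists v; rewrite inS nvz nvy.
  exists x; rewrite xS lab_xz -vz e; split=> //.
  by apply: (clt_trans _ xz); rewrite -?vz // lab_xz -vz (clt_conc vw).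
have uy := only u uw lab_uw; rewrite uy in uw lab_uw; split.
  apply/edgeP; split=> // v /betweenP[yv vw] e.
  by have := clt_neq yv; rewrite (only v) ?eqxx // e.
apply/negP=> /has_belowP[_ [v [_ vy e]]].
have := clt_neq vy; rewrite (only v) ?eqxx ?e //.
by apply: (clt_trans _ vy uw); rewrite e lab_uw conc_refl.
Qed.

(* Forgetting [y] merges the edge below it with the edge above it. *)
Let next_S w v : w \in S -> v \in S ->
  next_above S w v = nextT w v || (nextT w y && is_edge (y, v)).
Proof.
rewrite !inS => /andP[nwz nwy] /andP[nvz nvy].
apply/next_aboveP/orP => [[vS wv lab_wv no]|]; last first.
  case=> [/nextTP[wv lab_wv no]|/andP[/nextTP[wy lab_wy no] /edgeP[yv lab_yv noe]]].
    by rewrite inS nvz; split=> // u _; apply: no.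
  rewrite inS nvz; split=> //; last 1 first.
  - move=> u; rewrite inS => /andP[_ nuy] wu uv e.
    have Cuy : C (hlab u) (hlab y) by rewrite e lab_yv conc_refl.
    have [uy|uy|yu] := clt_total Cuy; first by rewrite uy eqxx in nuy.
      by apply: (no u); rewrite // e lab_yv.
    by apply: (noe u); rewrite ?inE ?yu // e lab_yv.
  - by apply: (clt_trans _ wy yv); rewrite -lab_yv (clt_conc wy).
  - by rewrite -lab_yv.
have [/existsP[u /and3P[wu uv /eqP lab_uv]]|nblk] :=
    boolP [exists u, [&& clt w u, clt u v & hlab u == hlab v]]; last first.
  left; apply/nextTP; split=> // u wu uv /eqP e.
  by case/negP: nblk; apply/existsP; exists u; rewrite wu uv.
right; have uS : u \notin S by apply/negP=> uS; apply: (no u).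
have [uz|nuz] := eqVneq u z.
  rewrite uz in wu uv lab_uv; case: (no x) => //; rewrite ?lab_xz //.
    apply: lower_x => //; first exact: clt_concV wu.
      by move=> wx; apply: lab_wv; rewrite wx lab_xz.
    exact/eqP.
  by apply: (clt_trans _ xz uv); rewrite lab_xz (clt_conc uv).
have uy : u = y by apply/eqP; move: uS; rewrite inS nuz negbK.
rewrite uy in wu uv lab_uv; apply/andP; split.
  apply/nextTP; split=> //; first by rewrite lab_uv.
  move=> t wt ty e; apply: (no t) => //; last by rewrite e.
    rewrite inS (clt_neq ty) andbT.
    by apply: contra_not_neq lab_yx => tz; rewrite -e tz lab_xz.
  by apply: (clt_trans _ ty uv); rewrite e lab_uv conc_refl.
apply/edgeP; split=> // t /betweenP[yt tv] e; apply: (no t) => //.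
- rewrite inS eq_sym [t == y]eq_sym (clt_neq yt) andbT.
  by apply: contra_not_neq lab_yx => zt; rewrite -e -zt lab_xz.
- by apply: (clt_trans _ wu yt); rewrite e (clt_conc wu).
- by rewrite e.
Qed.

Let next_z w : nextT w z -> w = y.
Proof. by move/next_upper; rewrite N1 => /set1P. Qed.

Let next_yz : nextT y z.
Proof.
apply/nextTP; split=> //; first by rewrite -lab_xz.
move=> u yu uz e; have := clt_neq yu; rewrite (inside _ uz) ?eqxx //.
by apply: (clt_trans _ xy yu); rewrite e lab_xz conc_refl.
Qed.

Let next_xy : nextT x y.
Proof.
apply/nextTP; split=> //; first exact/nesym.
move=> u xu uy e; have := clt_neq uy; rewrite (inside xu) ?eqxx //.
by apply: (clt_trans _ uy yz); rewrite e (clt_conc yz).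
Qed.

Let next_x_edge v : is_edge (y, v) -> nextT x v = false.
Proof.
case/edgeP=> yv lab_yv _; apply/negbTE/negP=> /nextTP[_ _ no].
exact: (no y xy yv).
Qed.

(* The rows of [x] and [z] differ only in the two edges ending and starting at
   [y]. *)
Let next_zE v : nextT z v = (nextT x v && (v != y)) || is_edge (y, v).
Proof.
apply/nextTP/orP=> [[zv lab_zv no]|[/andP[/nextTP[xv lab_xv no] nvy]|]].
- have Cxv : C (hlab x) (hlab v) by rewrite lab_xz (clt_conc zv).
  have [lab_vy|nlab] := eqVneq (hlab v) (hlab y).
    right; have yv : clt y v by apply: (clt_trans _ yz zv); rewrite lab_vy conc_refl.
    apply/edgeP; split=> // w /betweenP[yw wv] e.
    apply: (no w) => //; last by rewrite e lab_vy.
    apply: upper_z.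
    + by apply: (clt_trans _ xy yw); rewrite e (clt_conc xy).
    + by move=> wz; apply: lab_yx; rewrite -e wz lab_xz.
    + by apply/eqP; rewrite eq_sym (clt_neq yw).
  have nvy : v != y by apply: contraNneq nlab => ->.
  left; rewrite nvy andbT; apply/nextTP; rewrite lab_xz; split=> //.
    exact: clt_trans xz zv.
  move=> u xu uv e; apply: (no u) => //; apply: upper_z => //.
    by move=> uz; apply: lab_zv; rewrite -uz.
  by move=> uy; rewrite -e uy eqxx in nlab.
- rewrite -lab_xz; split=> //.
    apply: upper_z => //; last exact/eqP.
    by move=> vz; apply: lab_xv; rewrite vz.
  by move=> u zu uv; apply: no => //; apply: (clt_trans _ xz zu); rewrite lab_xz (clt_conc zu).
case/edgeP=> yv lab_yv no.
have lab_zv : hlab z <> hlab v by rewrite -lab_xz -lab_yv; apply/nesym.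
split=> //.
  apply: upper_z.
  + by apply: (clt_trans _ xy yv); rewrite -lab_yv (clt_conc xy).
  + by move=> vz; rewrite vz in lab_zv.
  + by apply/eqP; rewrite eq_sym (clt_neq yv).
move=> u zu uv e; apply: (no u); rewrite ?e // inE uv andbT.
by apply: (clt_trans _ yz zu); rewrite e -lab_yv conc_refl.
Qed.

(** Row [y] expresses the coefficient of the edge from [x] to [z] by the other
    ones.  Comparing rows [x] and [z] shows that the edges below and above [y]
    carry the same coefficient, which becomes that of the merged edge. *)
Lemma dim_ker_reduct_single : dim_ker k E = dim_ker k (subheap S).
Proof.
rewrite dim_ker_setT dim_ker_subheap.
pose above (g : {ffun E -> k^o}) : k^o := \sum_(v | is_edge (y, v)) g v.
have row_xz (g : {ffun E -> k^o}) : \sum_(v | nextT z v) g v =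
    \sum_(v | nextT x v) g v - g y + above g.
  rewrite (bigD1 y next_xy) /= [g y + _]addrC addrK.
  rewrite (bigID (fun v => is_edge (y, v))) /= addrC; congr (_ + _).
    apply: eq_bigl => v; rewrite next_zE; case e: (is_edge (y, v)).
      by rewrite next_x_edge.
    by rewrite orbF andbT.
  by apply: eq_bigl => v; rewrite next_zE andb_orl andbC; case: is_edge; rewrite ?orbT.
have above_uniq (g : {ffun E -> k^o}) w : is_edge (y, w) -> above g = g w.
  move=> yw; rewrite /above (bigD1 w) //= big1 ?addr0 // => v /andP[yv /eqP nvw].
  by case: nvw; apply: edge_upper_uniq yv yw.
have above_S (g h : {ffun E -> k^o}) : {in S, g =1 h} -> above g = above h.
  by move=> gh; apply: eq_bigr => v /edge_y/gh.
have next_aboveS w v : next_above S w v -> v \in S by case/next_aboveP.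
have row_S (g : {ffun E -> k^o}) w : w \in S -> g y = above g ->
    \sum_(v | next_above S w v) g v = \sum_(v | nextT w v) g v.
  move=> wS gy; have nwy : w != y by move: wS; rewrite inS => /andP[].
  have notz v : nextT w v -> v != y -> v \in S.
    move=> wv nvy; rewrite inS nvy andbT; apply: contraNneq nwy => vz.
    by apply/eqP/next_z; rewrite -vz.
  have [wy|nwy'] := boolP (nextT w y); last first.
    apply: eq_bigl => v; apply/idP/idP=> [wv|wv].
      by move: (wv); rewrite (next_S wS (next_aboveS _ _ wv)) (negbTE nwy') orbF.
    have vS : v \in S by apply: notz => //; apply: contraNneq nwy' => <-.
    by rewrite next_S // wv.
  rewrite (bigID (nextT w)) /= [RHS](bigD1 y) //= gy addrC; congr (_ + _).
    apply: eq_bigl => v; apply/andP/idP => [[wv nwv]|yv].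
      by move: (wv); rewrite (next_S wS (next_aboveS _ _ wv)) (negbTE nwv) wy.
    rewrite (next_S wS (edge_y yv)) wy yv orbT; split=> //.
    have [yv' lab_yv _] := edgeP _ _ yv; have [wy' _ _] := nextTP _ _ wy.
    by apply/negP=> /nextTP[_ _ no]; apply: (no y).
  apply: eq_bigl => v; apply/andP/andP => -[wv nvy]; split=> //.
    by move: (next_aboveS _ _ wv); rewrite inS => /andP[].
  by rewrite next_S ?wv // notz.
pose R (g : {ffun E -> k^o}) : {ffun E -> k^o} :=
  [ffun v => if v \in S then g v else 0].
have R_lin : linear R.
  move=> a f g; apply/ffunP=> v; rewrite !ffunE.
  by case: ifP; rewrite // scaler0 addr0.
pose Rl : {linear {ffun E -> k^o} -> {ffun E -> k^o}} :=
  HB.pack R (GRing.isLinear.Build _ _ _ _ R R_lin).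
have aboveT g : g \in cycles k [set: E] -> g y = above g.
  case/cyclesP=> _ g_row; have := row_xz g.
  rewrite [LHS]g_row ?inE // [X in X - _]g_row ?inE // sub0r => /esym/eqP.
  by rewrite addrC subr_eq0 => /eqP.
rewrite -(@limg_dim_eq _ _ _ (linfun Rl)); last first.
  apply/eqP; rewrite -subv0; apply/subvP=> g; rewrite memv_cap => /andP[gT].
  rewrite memv_ker lfunE /= => /eqP Rg0.
  have gS : {in S, g =1 (0 : {ffun E -> k^o})}.
    by move=> v vS; rewrite -(Rg0 : R g = 0) ffunE vS.
  have gy : g y = 0.
    rewrite aboveT // (above_S _ _ gS) /above big1 // => v _; exact: ffunE.
  rewrite memv0; apply/eqP/ffunP=> v; rewrite [RHS]ffunE.
  have [vS|] := boolP (v \in S); first by rewrite gS // ffunE.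
  rewrite inS negb_and !negbK => /orP[]/eqP-> //.
  have /cyclesP[_ /(_ y)] := gT; rewrite inE => /(_ isT).
  rewrite (bigD1 z) //= big1 ?addr0 // => u /andP[yu nuz].
  rewrite gS ?ffunE // inS nuz; have [yu' _ _] := nextTP _ _ yu.
  by rewrite eq_sym (clt_neq yu').
congr (\dim _); apply/eqP; rewrite eqEsubv; apply/andP; split; apply/subvP=> g.
  case/memv_imgP=> f fT ->; rewrite lfunE /=; have fy := aboveT _ fT.
  have /cyclesP[f_top f_row] := fT; apply/cyclesP; split=> [w nw|w wS].
    rewrite ffunE; case: ifP => // wS.
    have [wT|] := boolP (has_below [set: E] w); last exact: f_top.
    have [yw ny] := not_below_S wS wT nw.
    by rewrite -above_uniq // -fy f_top.
  rewrite -[RHS](f_row w) ?inE // -row_S //; apply: eq_bigr => v wv.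
  by rewrite ffunE (next_aboveS _ _ wv).
case/cyclesP=> h_top h_row.
(* The values at [y] and [z] are dictated by the rows of [z] and [y]. *)
pose f : {ffun E -> k^o} := [ffun v => if v == y then above g else
  if v == z then - \sum_(u | nextT y u && (u != z)) g u else g v].
have fS : {in S, f =1 g}.
  by move=> v; rewrite inS ffunE => /andP[/negbTE-> /negbTE->].
have fy : f y = above f by rewrite ffunE eqxx; apply/esym/above_S.
have frow w : w \in S -> \sum_(v | nextT w v) f v = 0.
  move=> wS; rewrite -row_S // -[RHS](h_row w) //.
  by apply: eq_bigr => v /next_aboveS/fS.
apply/memv_imgP; exists f; last first.
  rewrite lfunE; apply/ffunP=> v; rewrite [RHS]ffunE.
  case: ifP => [/fS->//|/negbT nv]; apply: h_top.
  by apply: contra nv => /has_belowP[].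
apply/cyclesP; split=> [w nw|w _].
  have [wS|] := boolP (w \in S).
    by rewrite fS // h_top //; apply: contra nw; apply: below_S.
  rewrite inS negb_and !negbK => /orP[]/eqP wE; rewrite wE in nw *.
    case/negP: nw; apply/has_belowP; rewrite inE; split=> //.
    by exists x; rewrite inE.
  rewrite ffunE eqxx /above big1 // => v yv; apply: h_top.
  have [yv' lab_yv no] := edgeP _ _ yv.
  apply/negP=> /has_belowP[_ [u [uS uv lab_uv]]].
  have Cuy : C (hlab u) (hlab y) by rewrite lab_uv lab_yv conc_refl.
  have [uy|uy|yu] := clt_total Cuy.
  - by move: uS; rewrite inS uy eqxx andbF.
  - case/negP: nw; apply/has_belowP; rewrite inE; split=> //.
    by exists u; rewrite inE lab_uv lab_yv.
  - by apply: (no u); rewrite ?inE ?yu // lab_uv lab_yv.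
have [wS|] := boolP (w \in S); first exact: frow.
rewrite inS negb_and !negbK => /orP[]/eqP ->.
  by rewrite [LHS]row_xz [X in X - _]frow // -fy sub0r addNr.
rewrite (bigD1 z) //= [f z]ffunE eqxx; have -> : z == y = false.
  by rewrite eq_sym; apply/negbTE/(clt_neq yz).
apply/eqP; rewrite addrC subr_eq0; apply/eqP/eq_bigr => v /andP[yv nvz].
have [yv' _ _] := nextTP _ _ yv.
by rewrite fS // inS nvz eq_sym (clt_neq yv').
Qed.
End Single.
End KernelOfReduct.

(** * Property P1 and acyclicity *)

Section Acyclicity.
Variables (k : fieldType) (P : choiceType) (C : concurrency P).
Implicit Types E F : heap C.

Lemma dim_ker_step m E F : step m E F -> dim_ker k E = (m + dim_ker k F)%N.
Proof.
case=> x [z [/[dup] xz_red /andP[xz_edge _] /(dim_ker_hiso k) <- ->]].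
rewrite /reduct; have [N0|[y yN]] := set_0Vmem (between x z).
  by rewrite N0 setU0 eqxx (dim_ker_reduct_empty k xz_edge N0).
have N1 := redex_between xz_red yN; rewrite N1.
have /negbTE-> : [set y] != set0 by apply/set0Pn; exists y; rewrite inE.
exact: (dim_ker_reduct_single k xz_edge N1).
Qed.

Lemma dim_ker_reduces m E F : reduces m E F -> dim_ker k E = (m + dim_ker k F)%N.
Proof.
elim=> {m E F} [E F /(dim_ker_hiso k)//|m n E E' F s _ IH].
by rewrite (dim_ker_step s) IH addnA.
Qed.

Lemma cycles_eq0 E : cycles k [set: E] = 0%VS -> dim_ker k E = 0%N.
Proof. by rewrite (dim_ker_setT k) => ->; apply: dimv0. Qed.

Lemma maximal_clt E (a b : E) : maximal a -> clt a b = false.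
Proof. by move=> /(_ b) h; apply: contraNF h => /andP[]. Qed.

Lemma minimal_clt E (a b : E) : minimal a -> clt b a = false.
Proof. by move=> /(_ b) h; apply: contraNF h => /andP[]. Qed.

(** As [b] lies below no vertex other than [a], a first generating step upwards
    from [b] leads to [a], which makes them concurrent. *)
Lemma prec_max_above E (a : E) : prec_max a -> exists b : E,
  [/\ clt b a, hlab b <> hlab a & forall v, clt b v -> v = a].
Proof.
case=> a_max [b [b_max lab_ba nb_max]]; exists (val b).
have only v : clt (val b) v -> v = a.
  move=> bv; apply/eqP/contraT=> va; have vS : v \in [set~ a] by rewrite !inE.
  by have := maximal_clt (Sub v vS : del a) b_max; rewrite sub_clt bv.
split=> //; last exact/eqP.
have [c bc] : exists c, hlt (val b) c.
  by apply: contrapT => no; apply: nb_max => c; apply/negP=> bc; apply: no; exists c.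
by have [d bd _] := hlt_clt_first bc; have da := only d bd; rewrite da in bd.
Qed.

Lemma prec_min_below E (a : E) : prec_min a -> exists b : E,
  [/\ clt a b, hlab b <> hlab a & forall v, clt v b -> v = a].
Proof.
case=> a_min [b [b_min lab_ba nb_min]]; exists (val b).
have only v : clt v (val b) -> v = a.
  move=> vb; apply/eqP/contraT=> va; have vS : v \in [set~ a] by rewrite !inE.
  by have := minimal_clt (Sub v vS : del a) b_min; rewrite sub_clt vb.
split=> //; last exact/eqP.
have [c cb] : exists c, hlt c (val b).
  by apply: contrapT => no; apply: nb_min => c; apply/negP=> cb; apply: no; exists c.
by have [d db _] := hlt_clt_last cb; have da := only d db; rewrite da in db.
Qed.

(** The vertex [b] witnessing the relation lies in no edge except the one
    ending at the new maximal vertex [a], whose coefficient therefore vanishes. *)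
Lemma dim_ker_prec_max E (a : E) : prec_max a ->
  dim_ker k (del a) = 0%N -> dim_ker k E = 0%N.
Proof.
move=> pa del0; have [b [ba lab_ba only]] := prec_max_above pa.
have [a_max _] := pa; apply: cycles_eq0.
move: del0; rewrite dim_ker_subheap => /eqP; rewrite dimv_eq0 => /eqP del0.
apply/eqP; rewrite -subv0 -{}del0; apply/subvP=> g /cyclesP[g_top g_row].
have inS v : (v \in [set~ a]) = (v != a) by rewrite !inE.
have ga : g a = 0.
  rewrite -[RHS](g_row b) ?inE // (bigD1 a) /=.
    by rewrite big1 ?addr0 // => v /andP[/next_aboveP[_ /only-> _ _]]; rewrite eqxx.
  apply/next_aboveP; rewrite inE; split=> // v _ /only->.
  by rewrite clt_irr.
apply/cyclesP; split=> [w|w wS].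
  have [->//|wa nw] := eqVneq w a; apply: g_top; apply: contra nw.
  case/has_belowP=> _ [x [_ xw lab_xw]]; apply/has_belowP; rewrite inS.
  split=> //; exists x; rewrite inS; split=> //.
  by apply: contraTneq xw => ->; rewrite maximal_clt.
rewrite -[RHS](g_row w) ?inE // [RHS](bigID (pred1 a)) /= [X in _ = X + _]big1 ?add0r.
  apply: eq_bigl => v; apply/next_aboveP/andP=> [[vS wv lab_wv no]|].
    split; last by rewrite -inS.
    apply/next_aboveP; rewrite inE; split=> // u _ wu uv.
    apply: no => //; rewrite inS.
    by apply: contraTneq uv => ->; rewrite maximal_clt.
  case=> /next_aboveP[_ wv lab_wv no] va; rewrite inS; split=> // u _.
  by apply: no; rewrite inE.
by move=> v /andP[_ /eqP->].
Qed.

(** Here [b] lies only in edges starting at [a]: the coefficient of such an edge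
    is carried by its upper end, which is no longer an upper end once [a] is
    deleted. *)
Lemma dim_ker_prec_min E (a : E) : prec_min a ->
  dim_ker k (del a) = 0%N -> dim_ker k E = 0%N.
Proof.
move=> pa del0; have [b [ab lab_ba only]] := prec_min_below pa.
have [a_min _] := pa; apply: cycles_eq0.
move: del0; rewrite dim_ker_subheap => /eqP; rewrite dimv_eq0 => /eqP del0.
apply/eqP; rewrite -subv0 -{}del0; apply/subvP=> g /cyclesP[g_top g_row].
have inS v : (v \in [set~ a]) = (v != a) by rewrite !inE.
have g_edge v : is_edge (a, v) -> g v = 0.
  case/edgeP=> av lab_av no; have bv : clt b v.
    have Cbv : C (hlab b) (hlab v) by rewrite -lab_av (clt_concV ab).
    have [e|//|vb] := clt_total Cbv; first by case: lab_ba; rewrite e.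
    by have := clt_neq av; rewrite (only v vb) eqxx.
  have next_bv : next_above [set: E] b v.
    apply/next_aboveP; rewrite inE; split=> //; first by rewrite -lab_av.
    move=> u _ bu uv e; apply: (no u); rewrite ?lab_av // inE uv andbT.
    by apply: (clt_trans _ ab bu); rewrite e lab_av conc_refl.
  rewrite -[RHS](g_row b) ?inE // (bigD1 v) //= big1 ?addr0 //.
  move=> u /andP[/next_aboveP[_ bu lab_bu nou] nuv].
  have [_ _ _ nov] := next_aboveP _ _ _ next_bv.
  apply: g_top; apply/negP=> /has_belowP[_ [t [_ tu lab_tu]]].
  have Ctb : C (hlab t) (hlab b) by rewrite lab_tu (clt_concV bu).
  have [tb|/only ta|bt] := clt_total Ctb; first by case: lab_bu; rewrite -tb.
    have lab_uv : hlab u = hlab v by rewrite -lab_tu ta.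
    have Cuv : C (hlab u) (hlab v) by rewrite lab_uv conc_refl.
    have [uv|uv|vu] := clt_total Cuv; first by rewrite uv eqxx in nuv.
      by apply: (nov u); rewrite ?inE.
    by apply: (nou v); rewrite ?inE.
  by apply: (nou t); rewrite ?inE.
apply/cyclesP; split=> [w nw|w wS].
  have [/has_belowP[_ [x [_ xw lab_xw]]]|] := boolP (has_below [set: E] w); last exact: g_top.
  have wa : w != a by apply: contraTneq xw => ->; rewrite minimal_clt.
  have below_a t : clt t w -> hlab t = hlab w -> t = a.
    move=> tw e; apply/eqP; apply: contraNT nw => ta; apply/has_belowP.
    by rewrite inS; split=> //; exists t; rewrite inS.
  have xa := below_a x xw lab_xw; rewrite xa in xw lab_xw.
  apply: g_edge; apply/edgeP; split=> // t /betweenP[at_ tw] e.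
  by have := clt_neq at_; rewrite (below_a t) ?eqxx // e.
rewrite -[RHS](g_row w) ?inE //; apply: eq_bigl => v.
apply/next_aboveP/next_aboveP=> -[vS wv lab_wv no]; split=> //.
- move=> u _ wu; apply: no => //; rewrite inS.
  by apply: contraTneq wu => ->; rewrite minimal_clt.
- by rewrite inS; apply: contraTneq wv => ->; rewrite minimal_clt.
- by move=> u _; apply: no; rewrite inE.
Qed.

Lemma P1_acyclic E : P1 E -> dim_ker k E = 0%N.
Proof.
elim=> {E} [E trivE|E' E _ IH [a [iso ext]]].
  apply: cycles_eq0; apply/eqP; rewrite -subv0; apply/subvP=> g /cyclesP[g_top _].
  rewrite memv0; apply/eqP/ffunP=> z; rewrite [RHS]ffunE; apply: g_top.
  apply/negP=> /has_belowP[_ [x [_ /andP[/andP[nxz xz] _] _]]].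
  by rewrite (trivE x z) ?eqxx in nxz.
have del0 : dim_ker k (del a) = 0%N by rewrite -(dim_ker_hiso k iso).
by case: ext => ext; [apply: dim_ker_prec_max del0 | apply: dim_ker_prec_min del0].
Qed.

End Acyclicity.

(** * Contractions in the Temperley-Lieb algebra *)

Lemma comm_erase_sq (R : comNzRingType) (A : algType R) (d : R) (p s b q : A) :
  s * s = d *: s -> s * b = b * s ->
  p * (s * (b * (s * q))) = d *: (p * (s * (b * q))).
Proof.
move=> ss sb; rewrite [b * (s * q)]mulrA -sb !mulrA -(mulrA p) ss.
by rewrite -scalerAr -!scalerAl.
Qed.

Lemma comm_erase_braid (A : nzRingType) (p s t b b' q : A) :
  s * (t * s) = s -> s * b = b * s -> s * b' = b' * s ->
  p * (s * (b * (t * (b' * (s * q))))) = p * (s * (b * (b' * q))).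
Proof.
move=> sts sb sb'; rewrite [b' * (s * q)]mulrA -sb' ![s * (b * _)]mulrA sb.
by rewrite -!mulrA [t * (s * _)]mulrA [s * (t * s * _)]mulrA sts.
Qed.

Section LinearExtensionRedex.
Variables (P : choiceType) (C : concurrency P).
Variables (E : heap C) (a b c : seq E) (x z : E).
Hypothesis ext : linear_extension (a ++ x :: b ++ z :: c).
Hypothesis lab_xz : hlab x = hlab z.

Let order : [/\ {in a, forall v, ~~ clt x v}, ~~ clt z x,
  {in b, forall v, ~~ clt v x /\ ~~ clt z v} & {in c, forall v, ~~ clt v z}].
Proof.
have /linear_extensionP[_ _] := ext; rewrite pairwise_cat /= pairwise_cat /=.
case/and5P=> /allrelP ha _ /allP hx /allrelP hb /andP[_ /andP[/allP hz _]].
split=> [v va||v vb|v]; last exact: hz.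
- by apply: ha; rewrite ?mem_head.
- by apply: hx; rewrite mem_cat mem_head orbT.
- by split; [apply: hx; rewrite mem_cat vb | apply: hb; rewrite ?mem_head].
Qed.

Let distinct : [/\ x != z, x \notin b & z \notin b].
Proof.
have /linear_extensionP[+ _ _] := ext.
rewrite cat_uniq /= mem_cat inE cat_uniq /= !negb_or => /and3P[_ _ /and4P[]].
by case/and3P=> -> -> _ _ /andP[->].
Qed.

Lemma linear_extension_clt : clt x z.
Proof.
have [nxz _ _] := distinct; have [_ nzx _ _] := order.
have Cxz : C (hlab x) (hlab z) by rewrite lab_xz conc_refl.
have [e|//|zx] := clt_total Cxz; first by rewrite e eqxx in nxz.
by rewrite zx in nzx.
Qed.

Lemma linear_extension_between v :
  (v \in between x z) = (v \in b) && C (hlab x) (hlab v).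
Proof.
have [nxz xb zb] := distinct; have [ha _ hb hc] := order.
apply/betweenP/andP=> [[xv vz]|[vb Cxv]].
  split; last exact: clt_conc xv.
  have /linear_extensionP[_ /(_ v) + _] := ext.
  rewrite mem_cat inE mem_cat inE => /or3P[/ha|/eqP vx|/or3P[//|/eqP vz'|/hc]].
  - by rewrite xv.
  - by rewrite vx clt_irr in xv.
  - by rewrite vz' clt_irr in vz.
  - by rewrite vz.
have [nvx nzv] := hb _ vb; have Cvz : C (hlab v) (hlab z).
  by rewrite -lab_xz conc_sym.
split.
  have [xv|//|vx] := clt_total Cxv; first by rewrite xv vb in xb.
  by rewrite vx in nvx.
have [vz|//|zv] := clt_total Cvz; first by rewrite -vz vb in zb.
by rewrite zv in nzv.
Qed.

Lemma heap_co_reduct : heap_co (reduct x z) = co_word C (map hlab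
  (a ++ x :: [seq v <- b | ~~ C (hlab x) (hlab v)] ++ c)).
Proof.
rewrite (heap_co_subheap _ ext); congr (co_word C (map hlab _)).
have /linear_extensionP[uniq_ext _ _] := ext.
have mem v : (v \in ~: (z |: between x z)) =
    (v != z) && ~~ ((v \in b) && C (hlab x) (hlab v)).
  by rewrite in_setC in_setU1 negb_or linear_extension_between.
have [nxz xb zb] := distinct.
have keep s : (forall v, v \in s -> v != z) -> (forall v, v \in s -> v \notin b) ->
    [seq v <- s | v \in ~: (z |: between x z)] = s.
  move=> sz sb; apply/all_filterP/allP=> v vs.
  by rewrite mem sz // (negbTE (sb v vs)).
move: uniq_ext; rewrite cat_uniq => /and3P[_ /hasPn dis_a].
rewrite /= mem_cat cat_uniq => /and3P[_ _ /andP[/hasPn dis_c /= /andP[zc _]]].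
have a_out v : v \in a -> v \notin x :: b ++ z :: c.
  by move=> va; apply/negP=> /dis_a; rewrite va.
rewrite filter_cat /= filter_cat /= !mem eqxx (negbTE xb) nxz /=.
rewrite (keep a) => [|v /a_out|v /a_out]; last 2 first.
- by apply: contraNneq => ->; rewrite inE mem_cat mem_head !orbT.
- by apply: contraNN => vb; rewrite inE mem_cat vb orbT.
rewrite (keep c) => [|v vc|v vc]; last 2 first.
- by apply: contraNneq zc => <-.
- by apply: dis_c; rewrite inE vc orbT.
congr (_ ++ _ :: _ ++ _); apply: eq_in_filter => v vb.
by rewrite mem vb; case: eqP => // vz; rewrite -vz vb in zb.
Qed.

End LinearExtensionRedex.

Section Words.
Variables (P : choiceType) (C : concurrency P).
Implicit Types E F G : heap C.

Definition word_tl (u : seq P) : TL C := tl_pi << co_word C u >>.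

Lemma heap_tl_co E u : heap_co E = co_word C u -> heap_tl E = word_tl u.
Proof. by rewrite /heap_tl => ->. Qed.

Lemma word_tl_cat u v : word_tl (u ++ v) = word_tl u * word_tl v.
Proof.
rewrite -[RHS]tl_piM /word_tl co_word_cat; congr tl_pi.
by rewrite malgM_def fgmulUU mulr1.
Qed.

Lemma word_tl_cons s u : word_tl (s :: u) = word_tl [:: s] * word_tl u.
Proof. exact: (word_tl_cat [:: s]). Qed.

Lemma word_tl_sq s : word_tl [:: s] * word_tl [:: s] = delta *: word_tl [:: s].
Proof. by rewrite -[LHS]tl_piM -[RHS]tl_piZ; apply/tl_piP/tl_sq. Qed.

Lemma word_tl_braid s t : s != t -> C s t ->
  word_tl [:: s] * (word_tl [:: t] * word_tl [:: s]) = word_tl [:: s].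
Proof.
by move=> nst Cst; rewrite mulrA -[_ * _ as X in X * _]tl_piM -[LHS]tl_piM;
  apply/tl_piP/tl_braid.
Qed.

Lemma word_tl_comm s u : all (fun t => ~~ C s t) u ->
  word_tl [:: s] * word_tl u = word_tl u * word_tl [:: s].
Proof.
elim: u => [|t u IH] /=; first by rewrite -!word_tl_cat.
case/andP=> nst /IH{}IH.
have st : word_tl [:: s] * word_tl [:: t] = word_tl [:: t] * word_tl [:: s].
  rewrite -!word_tl_cat /word_tl.
  by have /co_wordP-> : co_cong C ([:: s] ++ [:: t]) ([:: t] ++ [:: s]) by apply: co_swap.
rewrite (word_tl_cons t u). exact: (commrM st IH).
Qed.

Lemma word_tl_erase_sq s p b q : all (fun t => ~~ C s t) b ->
  word_tl (p ++ s :: b ++ s :: q) = delta *: word_tl (p ++ s :: b ++ q).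
Proof.
move=> /word_tl_comm sb; rewrite -(cat1s s (b ++ _)) -(cat1s s q).
rewrite -[s :: b ++ q]cat1s !word_tl_cat.
exact: comm_erase_sq (word_tl_sq s) sb.
Qed.

Lemma word_tl_erase_braid s t p b b' q : s != t -> C s t ->
    all (fun t => ~~ C s t) b -> all (fun t => ~~ C s t) b' ->
  word_tl (p ++ s :: b ++ t :: b' ++ s :: q) = word_tl (p ++ s :: b ++ b' ++ q).
Proof.
move=> nst Cst /word_tl_comm sb /word_tl_comm sb'.
rewrite -(cat1s s (b ++ _)) -(cat1s t) -(cat1s s q) -[s :: b ++ _]cat1s.
rewrite !word_tl_cat; exact: comm_erase_braid (word_tl_braid nst Cst) sb sb'.
Qed.

Lemma heap_tl_step m E F : step m E F -> heap_tl E = delta ^+ m *: heap_tl F.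
Proof.
case=> x [z [xz_red /heap_tl_hiso <- ->]].
have [xz lab_xz no N1] := redexP _ _ xz_red.
have [w ext] := linear_extension_exists E.
have /and3P[uw /forallP wE /forallP w_lt] := ext.
have /splitPr xw := wE x; case: xw ext uw wE w_lt => a w' ext uw wE w_lt.
have zw' : z \in w'.
  have := wE z; rewrite mem_cat inE eq_sym (negbTE (clt_neq xz)) /= => /orP[za|//].
  have /linear_extensionP[_ _] := ext; rewrite pairwise_cat => /andP[/allrelP h _].
  by have := h z x za (mem_head _ _); rewrite xz.
case/splitPr: zw' ext {uw wE w_lt} => b c ext.
rewrite (heap_tl_co (heap_co_linear_extension ext)).
rewrite (heap_tl_co (heap_co_reduct ext lab_xz)).
have bet v := linear_extension_between ext lab_xz v.
have [N0|[y yN]] := set_0Vmem (between x z).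
  have b_out v : v \in b -> ~~ C (hlab x) (hlab v).
    by move=> vb; have := bet v; rewrite N0 inE vb /= => <-.
  have -> : [seq v <- b | ~~ C (hlab x) (hlab v)] = b by apply/all_filterP/allP.
  rewrite N0 eqxx expr1 map_cat /= map_cat /= map_cat /= map_cat -lab_xz.
  by apply: word_tl_erase_sq; rewrite all_map; apply/allP.
have /negbTE-> : between x z != set0 by apply/set0Pn; exists y.
have := yN; rewrite bet => /andP[yb Cxy].
have nxy : hlab x != hlab y by rewrite eq_sym; apply/eqP/no.
case/splitPr: yb ext bet => b1 b2 ext bet.
have /linear_extensionP[uw _ _] := ext.
have b_out v : v \in b1 ++ b2 -> ~~ C (hlab x) (hlab v).
  move=> vb; apply/negP=> Cxv.
  have vy : v = y.
    apply: N1 => //; rewrite bet Cxv andbT; move: vb.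
    by rewrite !mem_cat inE => /orP[] -> //; rewrite !orbT.
  have ub : uniq (b1 ++ y :: b2).
    by move: uw; rewrite cat_uniq => /and3P[_ _ /= /andP[_]]; rewrite cat_uniq => /andP[].
  by move: ub vb; rewrite uniq_catC /= mem_cat vy mem_cat orbC => /andP[/negbTE->].
have -> : [seq v <- b1 ++ y :: b2 | ~~ C (hlab x) (hlab v)] = b1 ++ b2.
  rewrite filter_cat /= Cxy /= -filter_cat.
  by apply/all_filterP/allP.
rewrite expr0 scale1r -!(catA, cat_cons) !(map_cat, map_cons) -lab_xz.
apply: word_tl_erase_braid => //; rewrite all_map; apply/allP=> v vb;
  by apply: b_out; rewrite mem_cat vb ?orbT.
Qed.

End Words.

(** * Independence of the heaps with property P2 *)

Section DeltaPowers.
Let q : {poly int} := 'X^2 + 1.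

(* Multiplying by [lv] turns [delta] into the polynomial [q]. *)
Let delta_cleared n : val (delta ^+ n * lv ^+ n) = tofrac (q ^+ n).
Proof.
have dE : delta * lv = lv ^+ 2 + 1.
  by rewrite /delta mulrDl [lvV * _]mulrC lv_lvV.
rewrite -exprMn dE rmorphXn tofracXn; congr (_ ^+ n).
by rewrite tofracD tofrac1 tofracXn.
Qed.

Let q1 n : (q ^+ n).[1] = 2%:R ^+ n.
Proof. by rewrite horner_exp !hornerE. Qed.

(** Powers of [delta] are told apart by evaluating [q] at 1, where it is 2. *)
Lemma delta_exp_neq0 n : delta ^+ n != 0.
Proof.
apply/eqP=> d0; have := delta_cleared n; rewrite d0 mul0r rmorph0 => /esym/eqP.
rewrite tofrac_eq0 => /eqP/(congr1 (horner^~ 1)).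
by rewrite q1 horner0 => /eqP; rewrite expf_eq0 andbF.
Qed.

Lemma delta_exp_inj : injective (fun n => delta ^+ n).
Proof.
move=> m n /= dmn; have hm := delta_cleared m; have hn := delta_cleared n.
have: tofrac (q ^+ m * 'X^n) = tofrac (q ^+ n * 'X^m).
  rewrite !tofracM -hm -hn !tofracXn.
  have -> : tofrac 'X = val lv by [].
  by rewrite -!rmorphXn -!rmorphM dmn mulrAC.
move/eqP; rewrite tofrac_eq => /eqP/(congr1 (horner^~ 1)).
rewrite !hornerM !q1 !hornerXn !expr1n !mulr1 -!natrX => /eqP.
by rewrite Num.Theory.eqr_nat eqn_exp2l // => /eqP.
Qed.

End DeltaPowers.

Section Independence.
Variables (k : fieldType) (P : choiceType) (C : concurrency P).
Implicit Types E F G : heap C.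
Local Notation coAlg := {malg laurent[Co C]}.

Lemma reduces_hisor m E F F' : reduces m E F -> hiso F F' -> reduces m E F'.
Proof.
elim=> {m E F} [E F EF FF'|m n E E' F s _ IH FF'].
  by apply: reduces_refl; apply: hiso_trans FF'.
exact: reduces_step s (IH FF').
Qed.

Lemma heap_tl_reduces m E F : reduces m E F -> heap_tl E = delta ^+ m *: heap_tl F.
Proof.
elim=> {m E F} [E F /heap_tl_hiso->|m n E E' F s _ IH].
  by rewrite expr0 scale1r.
by rewrite (heap_tl_step s) IH scalerA exprD.
Qed.

Lemma map_cat_inv (T S : Type) (f : T -> S) (w : seq T) (u v : seq S) :
  map f w = u ++ v -> exists a b, [/\ w = a ++ b, map f a = u & map f b = v].
Proof.
move=> e; exists (take (size u) w), (drop (size u) w); split.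
- by rewrite cat_take_drop.
- by rewrite map_take e take_size_cat.
- by rewrite map_drop e drop_size_cat.
Qed.

Lemma step_word_sq E p s q : heap_co E = co_word C (p ++ [:: s; s] ++ q) ->
  exists2 F, step 1 E F & heap_co F = co_word C (p ++ [:: s] ++ q).
Proof.
case/heap_co_word=> w ext /map_cat_inv[a [[|x [|z c]] [we <- //]]] [].
move: ext; rewrite {}we => ext lab_x lab_z <-.
have lab_xz : hlab x = hlab z by rewrite lab_x lab_z.
have ext' : linear_extension (a ++ x :: [::] ++ z :: c) by [].
have N0 : between x z = set0.
  by apply/setP=> v; rewrite (linear_extension_between ext' lab_xz) inE.
exists (reduct x z); last first.
  by rewrite (heap_co_reduct ext' lab_xz) /= map_cat /= lab_x.
exists x, z; split; [|exact: hiso_refl|by rewrite N0 eqxx].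
apply/redexP; split=> //; first exact: (linear_extension_clt ext' lab_xz).
  by move=> v; rewrite N0 inE.
by move=> v v'; rewrite N0 inE.
Qed.

Lemma step_word_braid E p s t q : s != t -> C s t ->
    heap_co E = co_word C (p ++ [:: s; t; s] ++ q) ->
  exists2 F, step 0 E F & heap_co F = co_word C (p ++ [:: s] ++ q).
Proof.
move=> nst Cst.
case/heap_co_word=> w ext /map_cat_inv[a [[|x [|y [|z c]]] [we <- //]]] [].
move: ext; rewrite {}we => ext lab_x lab_y lab_z <-.
have lab_xz : hlab x = hlab z by rewrite lab_x lab_z.
have ext' : linear_extension (a ++ x :: [:: y] ++ z :: c) by [].
have N1 v : (v \in between x z) = (v == y).
  rewrite (linear_extension_between ext' lab_xz) inE.
  by case: eqP => // ->; rewrite lab_x lab_y.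
exists (reduct x z); last first.
  by rewrite (heap_co_reduct ext' lab_xz) /= lab_x lab_y Cst /= map_cat /= lab_x.
exists x, z; split; [|exact: hiso_refl|]; last first.
  by apply/esym/eqP; rewrite eqb0; apply/set0Pn; exists y; rewrite N1.
apply/redexP; split=> //; first exact: (linear_extension_clt ext' lab_xz).
  by move=> v; rewrite N1 => /eqP->; rewrite lab_x lab_y => /eqP; rewrite eq_sym (negbTE nst).
by move=> v v'; rewrite !N1 => /eqP-> /eqP->.
Qed.

(** The coefficient of the normal form [G] in [E].  The exponent is the number
    of factors [delta] produced by any reduction of [E] to [G]; expressed by
    kernel dimensions, it does not refer to a particular one. *)
Definition weight G E : laurent :=
  if `[< exists m, reduces m E G >] then delta ^+ (dim_ker k E - dim_ker k G)
  else 0.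

Lemma weight_hiso G E F : hiso E F -> weight G E = weight G F.
Proof.
move=> EF; rewrite /weight (dim_ker_hiso k EF).
congr (if _ then _ else _); apply/asboolP/asboolP=> -[m r]; exists m.
  exact: reduces_hisol r.
by apply: reduces_hisol r; apply: hiso_sym.
Qed.

Lemma weight_reduces m G E : reduces m E G -> weight G E = delta ^+ m.
Proof.
move=> r; rewrite /weight (dim_ker_reduces k r) addnK.
by case: asboolP => // -[]; exists m.
Qed.

Lemma weight_not_reduces G E : (forall m, ~ reduces m E G) -> weight G E = 0.
Proof. by move=> no; rewrite /weight; case: asboolP => // -[m /no]. Qed.

Lemma weight_step m G E F : P2 G -> step m E F ->
  weight G E = delta ^+ m * weight G F.
Proof.
move=> hG s; have [[n r]|no] := pselect (exists n, reduces n F G).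
  by rewrite (weight_reduces r) (weight_reduces (reduces_step s r)) exprD.
rewrite !weight_not_reduces ?mulr0 // => n r; apply: no; first by exists n.
have [n' [G' [r' hG']]] := reduces_P2 F; exists n'; apply: (reduces_hisor r').
exact: (reduces_unique (reduces_step s r') hG' r hG).
Qed.

Definition normal_coeff G (x : coAlg) : laurent :=
  mmap idfun (fun u => weight G (co_heap u)) x.

Lemma normal_coeffU G c E :
  normal_coeff G << c *g heap_co E >> = c * weight G E.
Proof.
rewrite /normal_coeff mmapU /=; congr (_ * _); apply: weight_hiso.
by apply: heap_co_inj; rewrite co_heapK.
Qed.

Lemma malg_wordM (c d : laurent) u v :
  << c *g co_word C u >> * << d *g co_word C v >> =
  << c * d *g co_word C (u ++ v) >> :> coAlg.
Proof. by rewrite co_word_cat malgM_def fgmulUU. Qed.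

(** By bilinearity it suffices to multiply a generator of the ideal by words on
    both sides, and the two terms are then a heap and one of its reducts. *)
Lemma normal_coeff_ideal G x : P2 G -> tl_ideal x ->
  forall a b : coAlg, normal_coeff G (a * x * b) = 0.
Proof.
move=> hG; have phiB : {morph normal_coeff G : x y / x - y}.
  by move=> y z; apply: mmapB.
have ideal0 y : (forall (c d : laurent) (u v : seq P),
      normal_coeff G (<< c *g co_word C u >> * y * << d *g co_word C v >>) = 0) ->
    forall a b : coAlg, normal_coeff G (a * y * b) = 0.
  have phi_sum (I : Type) (r : seq I) (f : I -> coAlg) :
      (forall i, normal_coeff G (f i) = 0) -> normal_coeff G (\sum_(i <- r) f i) = 0.
    move=> f0; rewrite [LHS](raddf_sum (mmap idfun _)) big1 // => i _; exact: f0.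
  move=> y0 a b; rewrite (monalgE a) (monalgE b) -mulrA mulr_suml.
  apply: (@phi_sum) => u; rewrite mulrA mulr_sumr; apply: phi_sum => v.
  by rewrite -[u]co_wordK -[v]co_wordK; apply: y0.
have coeffZ c u : normal_coeff G << c *g co_word C u >> =
    c * normal_coeff G << co_word C u >>.
  by rewrite /normal_coeff !mmapU /= mul1r.
have coeff_step m u v (c : laurent) :
    (forall E, heap_co E = co_word C u ->
       exists2 F, step m E F & heap_co F = co_word C v) ->
    normal_coeff G << c *g co_word C u >> =
    c * (delta ^+ m * normal_coeff G << co_word C v >>).
  move=> uv; have uE := heap_co_word_heap C u.
  have [F s vF] := uv _ uE; rewrite -uE -vF !normal_coeffU mul1r.
  by rewrite (weight_step hG s).
elim=> {x} [s|s t nst Cst||x y _ hx _ hy|a' x _ hx|a' x _ hx].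
- apply: (@ideal0) => c d u v; rewrite mulrBr mulrBl phiB -mul_malgC /co_gen.
  rewrite !malg_wordM !mul1r !mulr1 -!catA (coeffZ (c * delta * d)).
  rewrite (coeff_step 1 _ (u ++ [:: s] ++ v)) => [|E]; last exact: step_word_sq.
  by rewrite expr1 [c * delta * d]mulrAC !mulrA subrr.
- apply: (@ideal0) => c d u v; rewrite mulrBr mulrBl phiB /co_gen.
  rewrite !malg_wordM !mulr1 -!catA.
  rewrite (coeff_step 0 _ (u ++ [:: s] ++ v)) => [|E]; last exact: step_word_braid.
  by rewrite expr0 mul1r (coeffZ (c * d)) subrr.
- move=> a b; rewrite mulr0 mul0r; exact: mmap0.
- move=> a b; have -> : a * (x - y) * b = a * x * b - a * y * b.
    by rewrite (mulrBr a) (mulrBl b).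
  apply: etrans (phiB _ _) _.
  exact: etrans (congr2 (fun c d => c - d) (hx a b) (hy a b)) (subr0 0).
- move=> a b; rewrite (mulrA a); exact: hx.
- move=> a b; rewrite (mulrA a) -(mulrA _ a'); exact: hx.
Qed.

(** The functional attached to the normal form of [D] takes a power of [delta] as
    its value at [D], hence does not vanish at [G]; so [G], being irreducible, is
    this normal form, and comparing the two powers of [delta] gives [m]. *)
Lemma normal_form_unique m D G : P2 G -> heap_tl D = delta ^+ m *: heap_tl G ->
  reduces m D G.
Proof.
move=> hG; have [e [G' [r hG']]] := reduces_P2 D.
rewrite -[RHS]tl_piZ => /tl_piP /(normal_coeff_ideal hG')/(_ 1 1).
rewrite mul1r mulr1 -mul_malgC => /eqP.
rewrite [normal_coeff _ _]mmapB subr_eq0 => /eqP.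
rewrite -[LHS]/(normal_coeff G' _) -[RHS]/(normal_coeff G' _).
rewrite malgM_def fgmulUU mulr1 mul1m !normal_coeffU mul1r (weight_reduces r).
have [[n r']|no] := pselect (exists n, reduces n G G'); last first.
  rewrite (weight_not_reduces (fun n h => no (ex_intro _ n h))) mulr0 => /eqP.
  by rewrite (negbTE (delta_exp_neq0 _)).
have GG' : hiso G G'.
  by case: r' hG => // m1 n1 E E' F s _ hE; case: (P2_step hE s).
have rG : reduces 0 G G' := reduces_refl GG'.
rewrite (weight_reduces rG) expr0 mulr1 => /delta_exp_inj <-.
by apply: reduces_hisor r _; apply: hiso_sym.
Qed.

End Independence.

Theorem theorem3p2p3 (k : fieldType) (P : choiceType) (C : concurrency P) :
  (forall D : heap C, exists G : heap C,
    [/\ P2 G,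
        exists m : nat, heap_tl D = delta ^+ m *: heap_tl G,
        forall G' : heap C, P2 G' ->
          (exists m : nat, heap_tl D = delta ^+ m *: heap_tl G') -> hiso G G'
      & forall m : nat, heap_tl D = delta ^+ m *: heap_tl G ->
          dim_ker k D = (m + dim_ker k G)%N /\
          (regular C -> m = dim_ker k D)])
  /\
  (regular C -> forall E F : heap C, P2 E -> P2 F ->
    exists G : heap C, P2 G /\
      heap_tl (superposition E F) =
        delta ^+ dim_ker k (superposition E F) *: heap_tl G).
Proof.
have exponent (D G : heap C) m : P2 G -> heap_tl D = delta ^+ m *: heap_tl G ->
    dim_ker k D = (m + dim_ker k G)%N /\ (regular C -> m = dim_ker k D).
  move=> hG /(normal_form_unique k hG)/(dim_ker_reduces k) dimE; split=> // reg.
  by rewrite dimE (P1_acyclic k (reg G hG)) addn0.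
split=> [D|reg E F _ _].
  have [m [G [r hG]]] := reduces_P2 D; exists G; split=> //.
  - by exists m; apply: heap_tl_reduces.
  - move=> G' hG' [m' /(normal_form_unique k hG') r'].
    exact: reduces_unique r hG r' hG'.
  - by move=> m' /(exponent _ _ _ hG).
have [m [G [/heap_tl_reduces e hG]]] := reduces_P2 (superposition E F).
by exists G; split=> //; have [_ /(_ reg) <-] := exponent _ _ _ hG e.
Qed.
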